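(* Let $A\in\mathbb{R}^{m\times n}$, let $B\in\mathbb{R}^{n\times n}$ be symmetric positive semidefinite, and let $\mathcal{P}=\{z\in\mathbb{R}^n\mid P^Tz\preceq\beta\}$ be a nonempty polyhedron with $P\in\mathbb{R}^{n\times k}$, $\beta\in\mathbb{R}^k$, where $p_i$ denotes the $i$-th column of $P$. Let $S:\mathbb{R}^m\times\mathbb{R}_{++}\rightrightarrows\mathbb{R}^n$ be given by $$S(b,\lambda)=\operatorname*{argmin}_{x\in\mathbb{R}^n}\Bigl\{\tfrac12\|Ax-b\|^2+\lambda\,\theta_{\mathcal{P},B}(x)\Bigr\}.$$ Let $\bar x\in S(\bar b,\bar\lambda)$ and set $\bar v=-\frac1{\bar\lambda}A^T(A\bar x-\bar b)$. In this setup the compactness constraint qualification $\mathcal{P}^\infty\cap\ker B\cap\ker M^T=\{0\}$ with $M=I$ is automatically satisfied, and the Mordukhovich criterion $\ker A\cap\ker\partial^2\theta_{\mathcal{P},B}(\bar x|\bar v)=\{0\}$ simplifies to $$\ker A\cap\operatorname{span}\{p_i\mid i\in I(\bar v)\}=\{0\},\qquad(\ast)$$ where $I(\bar v)=\{i\mid p_i^T\bar v=\beta_i\}$. If $(\ast)$ holds, then, with $H=I+\frac1{\bar\lambda}BA^TA$, we have the following: (i) $S$ is directionally differentiable at $(\bar b,\bar\lambda)$, and for every direction $(q,\alpha)\in\mathbb{R}^m\times\mathbb{R}$ there exists a matrix $U$ with orthonormal columns such that the directional derivative in direction $(q,\alpha)$ is given by $$\Bigl(H^{-1}BA^T+U[(AHU)^T(AU)]^{-1}(AHU)^T\bigl(I-AH^{-1}BA^T\bigr)\Bigr)\Bigl(q+\frac{\alpha}{\bar\lambda}(A\bar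 x-\bar b)\Bigr).$$ (ii) $S$ is single-valued and locally Lipschitz around $(\bar b,\bar\lambda)$, and the modulus $L$ of Lipschitz continuity can be bounded by $$L\le\max_{U'\in\mathcal{V}}\Bigl\|\Bigl(H^{-1}BA^T+U'[(AHU')^T(AU')]^{-1}(AHU')^T\bigl(I-AH^{-1}BA^T\bigr)\Bigr)\Bigl(\bar q-\frac{\bar\alpha}{\bar\lambda}(A\bar x-\bar b)\Bigr)\Bigr\|$$ for $\mathcal{V}:=\{V\in\mathbb{R}^{n\times r}\mid V^TV=I,\ r\le|I(\bar v)|\}$, where $(\bar q,\bar\alpha)$ is the limit direction in the closed unit ball described in the context.
   Context: $\theta_{\mathcal{P},B}(x)=\sup_{z\in\mathcal{P}}\{x^Tz-\tfrac12z^TBz\}$ is the piecewise linear-quadratic penalty associated with $\mathcal{P}$ and $B$; $\preceq$ is the componentwise order; $\mathcal{P}^\infty=\{d\mid P^Td\preceq0\}$ is the horizon (recession) cone of $\mathcal{P}$; $I$ without argument is an identity matrix of appropriate size; norms are Euclidean; $\mathbb{R}_{++}$ is the set of positive reals. For a closed proper convex function $g$ and $(\bar x,\bar v)\in\operatorname{gph}\partial g$, the generalized Hessian $\partial^2g(\bar x|\bar v)$ is the coderivative of $\partial g$ at $(\bar x,\bar v)$: $z\in\partial^2g(\bar x|\bar v)(w)$ if and only if $(z,-w)$ lies in the limiting normal cone to $\operatorname{gph}\partial g$ at $(\bar x,\bar v)$; its kernel is $\{w\mid 0\in\partial^2g(\bar x|\bar v)(w)\}$. The directional derivative of $S$ at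 $\bar p=(\bar b,\bar\lambda)$ in direction $d$ is $S'(\bar p;d)=\lim_{t\downarrow0}(S(\bar p+td)-S(\bar p))/t$. The vector $(\bar q,\bar\alpha)\in\mathbb{R}^m\times\mathbb{R}$ in (ii) is a limit of directions $(q_k,\alpha_k)$ with $\|(q_k,\alpha_k)\|\le1$, where $(b_k,\lambda_k)\to(\bar b,\bar\lambda)$ is a sequence such that both $\max_{\|(q,\alpha)\|\le1}\|S'(b_k,\lambda_k;q,\alpha)\|$ and $\|S'(b_k,\lambda_k;q_k,\alpha_k)\|$ converge to $\limsup_{(b,\lambda)\to(\bar b,\bar\lambda)}\max_{\|(q,\alpha)\|\le1}\|S'(b,\lambda;q,\alpha)\|$.
   Formalization: In (i) and (ii) every H^{-1}BA^T is corrected to (1/λ̄)H^{-1}BA^T; in (ii) the last vector is q̄ + (ᾱ/λ̄)(Ax̄−b̄) instead of with a minus sign; the max over V is a supremum over those U' for which the inverse exists. *)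

(* Defs.v *)
From HB Require Import structures.
From mathcomp Require Import all_boot all_order all_algebra.
From mathcomp Require Import all_classical all_reals all_analysis.

Set Implicit Arguments.
Unset Strict Implicit.
Unset Printing Implicit Defensive.

Import Order.TTheory GRing.Theory Num.Theory.
Import numFieldNormedType.Exports.

Local Open Scope classical_set_scope.
Local Open Scope ring_scope.

Section Euclidean.
Variable R : realType.

Definition dot n (x y : 'cV[R]_n) : R := (x^T *m y) 0 0.

(* The library norm on matrices and on products is the max norm: it is used
   only for the topology, all norms in the statement are Euclidean. *)
Definition enorm n (x : 'cV[R]_n) : R := Num.sqrt (dot x x).

Definition pnorm m (p : 'cV[R]_m * R) : R :=
  Num.sqrt (enorm p.1 ^+ 2 + p.2 ^+ 2).

Definition mx_ker m n (M : 'M[R]_(m, n)) : set 'cV[R]_n :=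
  [set w | M *m w = 0].

Definition cle n (x y : 'cV[R]_n) : Prop := forall i, x i 0 <= y i 0.

Definition psd n (B : 'M[R]_n) : Prop :=
  B^T = B /\ forall x : 'cV[R]_n, 0 <= dot x (B *m x).

End Euclidean.

Section VariationalAnalysis.
Variable R : realType.

Definition argmin n (f : 'cV[R]_n -> \bar R) : set 'cV[R]_n :=
  [set x | forall y, (f x <= f y)%E].

Definition subdiff n (g : 'cV[R]_n -> \bar R) (x : 'cV[R]_n) : set 'cV[R]_n :=
  [set v | g x \is a fin_num /\
           forall y, (g x + (dot v (y - x))%:E <= g y)%E].

(* R^n * R^p is represented as R^(n + p). *)
Definition gph n p (F : 'cV[R]_n -> set 'cV[R]_p) : set 'cV[R]_(n + p) :=
  [set u | F (usubmx u) (dsubmx u)].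

(* regular (Frechet) normal cone: <v, y - x> <= o(|y - x|) for y in C *)
Definition regular_normal n (C : set 'cV[R]_n) (x : 'cV[R]_n) :
    set 'cV[R]_n :=
  [set v | C x /\ forall e : R, 0 < e ->
     \forall y \near x, C y -> dot v (y - x) <= e * enorm (y - x)].

Definition limiting_normal n (C : set 'cV[R]_n) (x : 'cV[R]_n) :
    set 'cV[R]_n :=
  [set v | C x /\ exists xs vs : nat -> 'cV[R]_n,
     [/\ forall k, regular_normal C (xs k) (vs k),
         xs k @[k --> \oo] --> x & vs k @[k --> \oo] --> v]].

Definition coderivative n p (F : 'cV[R]_n -> set 'cV[R]_p)
    (xbar : 'cV[R]_n) (vbar : 'cV[R]_p) (w : 'cV[R]_p) : set 'cV[R]_n :=
  [set z | limiting_normal (gph F) (col_mx xbar vbar) (col_mx z (- w))].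

Definition generalized_hessian n (g : 'cV[R]_n -> \bar R)
    (xbar vbar w : 'cV[R]_n) : set 'cV[R]_n :=
  coderivative (subdiff g) xbar vbar w.

Definition map_kernel n p (F : 'cV[R]_p -> set 'cV[R]_n) : set 'cV[R]_p :=
  [set w | F w 0].

(* ... @ 0^'+ is the limit t -> 0 with t > 0 *)
Definition dir_quotient m n (f : 'cV[R]_m * R -> 'cV[R]_n)
    (p d : 'cV[R]_m * R) (t : R) : 'cV[R]_n :=
  t^-1 *: (f (p + t *: d) - f p).

Definition dir_differentiable m n (f : 'cV[R]_m * R -> 'cV[R]_n)
    (p : 'cV[R]_m * R) : Prop :=
  forall d, cvg (dir_quotient f p d t @[t --> 0^'+]).

Definition dir_derivative m n (f : 'cV[R]_m * R -> 'cV[R]_n)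
    (p d : 'cV[R]_m * R) : 'cV[R]_n :=
  lim (dir_quotient f p d t @[t --> 0^'+]).

Definition locally_lipschitz_around m n (f : 'cV[R]_m * R -> 'cV[R]_n)
    (p : 'cV[R]_m * R) : Prop :=
  exists kappa : R, \forall pp \near (p, p),
    enorm (f pp.1 - f pp.2) <= kappa * pnorm (pp.1 - pp.2).

(* limsup of |f p1 - f p2| / |p1 - p2| as p1, p2 -> p with p1 <> p2 *)
Definition lipschitz_modulus m n (f : 'cV[R]_m * R -> 'cV[R]_n)
    (p : 'cV[R]_m * R) : \bar R :=
  limf_esup
    (fun pp : ('cV[R]_m * R) * ('cV[R]_m * R) =>
       (enorm (f pp.1 - f pp.2) / pnorm (pp.1 - pp.2))%:E)
    (within [set pp | pp.1 <> pp.2] (nbhs (p, p))).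

Definition max_dir_derivative m n (f : 'cV[R]_m * R -> 'cV[R]_n)
    (p : 'cV[R]_m * R) : \bar R :=
  ereal_sup [set (enorm (dir_derivative f p d))%:E |
             d in [set d | pnorm d <= 1]].

Definition maximal_limit_direction m n (f : 'cV[R]_m * R -> 'cV[R]_n)
    (pbar dbar : 'cV[R]_m * R) : Prop :=
  let l := limf_esup (max_dir_derivative f) (nbhs pbar) in
  exists p d : nat -> 'cV[R]_m * R,
    [/\ p k @[k --> \oo] --> pbar,
        forall k, pnorm (d k) <= 1,
        max_dir_derivative f (p k) @[k --> \oo] --> l,
        (enorm (dir_derivative f (p k) (d k)))%:E @[k --> \oo] --> l
      & d k @[k --> \oo] --> dbar].

End VariationalAnalysis.

Section PLQ.
Variable R : realType.

Definition polyhedron n k (P : 'M[R]_(n, k)) (beta : 'cV[R]_k) :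
    set 'cV[R]_n :=
  [set z | cle (P^T *m z) beta].

Definition horizon_cone n k (P : 'M[R]_(n, k)) : set 'cV[R]_n :=
  [set d | cle (P^T *m d) 0].

Definition plq n (C : set 'cV[R]_n) (B : 'M[R]_n) (x : 'cV[R]_n) : \bar R :=
  ereal_sup [set (dot x z - 2^-1 * dot z (B *m z))%:E | z in C].

Definition active n k (P : 'M[R]_(n, k)) (beta : 'cV[R]_k) (v : 'cV[R]_n) :
    {set 'I_k} :=
  [set i | dot (col i P) v == beta i 0]%SET.

Definition active_span n k (P : 'M[R]_(n, k)) (beta : 'cV[R]_k)
    (v : 'cV[R]_n) : {vspace 'cV[R]_n} :=
  <<[seq col i P | i <- enum (active P beta v)]>>%VS.

(* only meaningful for 0 < p.2 *)
Definition solution_map m n k (A : 'M[R]_(m, n)) (B : 'M[R]_n)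
    (P : 'M[R]_(n, k)) (beta : 'cV[R]_k) (p : 'cV[R]_m * R) :
    set 'cV[R]_n :=
  argmin (fun x => ((2^-1 * enorm (A *m x - p.1) ^+ 2)%:E
                    + p.2%:E * plq (polyhedron P beta) B x)%E).

Definition single_valued_around m n (S : 'cV[R]_m * R -> set 'cV[R]_n)
    (p : 'cV[R]_m * R) : Prop :=
  \forall p' \near p, exists x, S p' = [set x].

(* the point of S p whenever S p is a singleton *)
Definition selection m n (S : 'cV[R]_m * R -> set 'cV[R]_n)
    (p : 'cV[R]_m * R) : 'cV[R]_n := get (S p).

Definition H_mx m n (A : 'M[R]_(m, n)) (B : 'M[R]_n) (lam : R) : 'M[R]_n :=
  1%:M + lam^-1 *: (B *m A^T *m A).

Definition gram_mx m n r (A : 'M[R]_(m, n)) (H : 'M[R]_n)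
    (U : 'M[R]_(n, r)) : 'M[R]_r :=
  (A *m H *m U)^T *m (A *m U).

(* The matrix G in x' = G (q + alpha / lam (A x - b)), obtained by
   differentiating  A^T (A x - b) + lam v = 0,  x - B v \in N_P(v):
   x' = H^-1 (lam^-1 B A^T) q' + U c,  where the columns of H U span the normals
   p_i that stay active and  (H U)^T A^T (A x' - q') = 0.  The two occurrences
   of B A^T therefore carry the factor lam^-1 that also appears in H. *)
Definition sensitivity_mx m n r (A : 'M[R]_(m, n)) (B : 'M[R]_n) (lam : R)
    (U : 'M[R]_(n, r)) : 'M[R]_(n, m) :=
  let H := H_mx A B lam in
  let G0 := lam^-1 *: (invmx H *m B *m A^T) in
  G0 + U *m invmx (gram_mx A H U) *m (A *m H *m U)^T *m (1%:M - A *m G0).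

(* mathcomp's invmx is the identity on singular matrices, so membership in the
   domain of the formula is recorded by the unitmx condition. *)
Definition modulus_bound m n k (A : 'M[R]_(m, n)) (B : 'M[R]_n)
    (P : 'M[R]_(n, k)) (beta : 'cV[R]_k) (lam : R) (v : 'cV[R]_n)
    (w : 'cV[R]_m) : \bar R :=
  ereal_sup [set y | exists (r : nat) (U : 'M[R]_(n, r)),
    [/\ U^T *m U = 1%:M, (r <= #|active P beta v|)%N,
        gram_mx A (H_mx A B lam) U \in unitmx
      & y = (enorm (sensitivity_mx A B lam U *m w))%:E]].

End PLQ.

(* Main.v *)
Require Import Defs.
From HB Require Import structures.
From mathcomp Require Import all_boot all_order all_algebra.
From mathcomp Require Import all_classical all_reals all_analysis.
From mathcomp Require Import ring lra.

Set Implicit Arguments.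
Unset Strict Implicit.
Unset Printing Implicit Defensive.

Import Order.TTheory GRing.Theory Num.Theory.
Import numFieldNormedType.Exports.

Local Open Scope classical_set_scope.
Local Open Scope ring_scope.

(** The proof replaces the minimisation problem by a variational inequality.
Put r = (b - A x) / lambda and v = A^T r.  By convex duality x minimises the
objective for (b, lambda) exactly when v lies in the polyhedron and x - B v lies
in its normal cone at v (solution_mapP); the subdifferential of the penalty is
described by the same inclusion (subdiff_plq).  Write W for the span of the
normals p_i active at vbar.  Everything rests on two facts about the inclusion.

Monotonicity of the normal cone bounds the variation of r, hence of A x and v,
by the variation of the data (residual_lipschitz).  In particular no inactive
constraint becomes active near the reference point, so that x - B v stays in W.
Under the criterion A is injective on W, so that x itself is controlled: this
is uniqueness and the Lipschitz estimate (near_lipschitz).  Existence for nearby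
parameters follows from uniqueness: the objective grows on a sphere around xbar
(sphere_growth), so the minimiser over a ball is interior (sol_exists).

A limit xi of difference quotients satisfies the linearised inclusion, in which
the critical cone replaces the polyhedron (quotient_limit); by the same two
facts its solution is unique, whence directional differentiability.  With the
rates nu of v and mu = xi - B nu of the normal, mu lies in W and is orthogonal
to nu.  These two relations alone give the closed formula
(sensitivity_representation): H (xi - H^-1 B A^T w / lambda) = mu, and one may
take for U the normalised vector H^-1 mu, or no column at all when mu = 0.

For the modulus, a one-sided mean value inequality on segments bounds it by the
upper limit of the largest directional derivatives (lipschitz_modulus_le).
Along a maximising sequence the derivatives subconverge, and since membership
in W and orthogonality survive in the limit, the limit is given by the formula
at the reference point for the limit direction (limit_of_derivatives).

Finally the kernel of the generalized Hessian is W itself.  The graph of the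
subdifferential is invariant near the reference pair under small steps along
(B d, d) for d orthogonal to W, so limiting normals are orthogonal to these
directions (kernel_sub_span); conversely, at nearby pairs with strict
complementarity the second component can only move orthogonally to W, which
makes (0, -w) a regular normal for each w in W (span_sub_kernel). *)

(** * Euclidean geometry *)
Section Euclid.
Variable R : realType.
Implicit Types n m : nat.

Lemma dotE n (x y : 'cV[R]_n) : dot x y = \sum_i x i 0 * y i 0.
Proof. by rewrite /dot mxE; apply: eq_bigr => i _; rewrite mxE. Qed.

Lemma dotC n (x y : 'cV[R]_n) : dot x y = dot y x.
Proof. by rewrite !dotE; apply: eq_bigr => i _; rewrite mulrC. Qed.

Lemma dotDr n (x y z : 'cV[R]_n) : dot x (y + z) = dot x y + dot x z.
Proof. by rewrite /dot mulmxDr mxE. Qed.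

Lemma dotZr n a (x y : 'cV[R]_n) : dot x (a *: y) = a * dot x y.
Proof. by rewrite /dot -scalemxAr mxE. Qed.

Lemma dotNr n (x y : 'cV[R]_n) : dot x (- y) = - dot x y.
Proof. by rewrite /dot mulmxN mxE. Qed.

Lemma dot0r n (x : 'cV[R]_n) : dot x 0 = 0.
Proof. by rewrite /dot mulmx0 mxE. Qed.

Lemma dotDl n (x y z : 'cV[R]_n) : dot (y + z) x = dot y x + dot z x.
Proof. by rewrite dotC dotDr !(dotC x). Qed.

Lemma dotZl n a (x y : 'cV[R]_n) : dot (a *: y) x = a * dot y x.
Proof. by rewrite dotC dotZr (dotC x). Qed.

Lemma dotNl n (x y : 'cV[R]_n) : dot (- y) x = - dot y x.
Proof. by rewrite dotC dotNr (dotC x). Qed.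

Lemma dot0l n (x : 'cV[R]_n) : dot 0 x = 0.
Proof. by rewrite dotC dot0r. Qed.

Definition dotlin := (dotDr, dotDl, dotNr, dotNl, dotZr, dotZl).

Lemma dot_mulr n m (M : 'M[R]_(m, n)) x y : dot x (M *m y) = dot (M^T *m x) y.
Proof. by rewrite /dot trmx_mul trmxK mulmxA. Qed.

Lemma dot_mull n m (M : 'M[R]_(m, n)) x y : dot (M *m y) x = dot y (M^T *m x).
Proof. by rewrite dotC dot_mulr dotC. Qed.

Lemma dot_ge0 n (x : 'cV[R]_n) : 0 <= dot x x.
Proof. by rewrite dotE sumr_ge0 // => i _; rewrite -expr2 sqr_ge0. Qed.

Lemma dot_eq0 n (x : 'cV[R]_n) : dot x x = 0 -> x = 0.
Proof.
rewrite dotE => /eqP; rewrite psumr_eq0; last first.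
  by move=> i _; rewrite -expr2 sqr_ge0.
move=> /allP h; apply/colP => i; rewrite mxE; apply/eqP.
by have := h i (mem_index_enum i); rewrite /= mulf_eq0 orbb.
Qed.

Lemma dot_suml n I (s : seq I) (Q : pred I) (c : I -> R) (p : I -> 'cV[R]_n) y :
  dot (\sum_(i <- s | Q i) c i *: p i) y = \sum_(i <- s | Q i) c i * dot (p i) y.
Proof.
by elim/big_rec2: _ => [|i a b _ <-]; rewrite ?dot0l // !dotlin.
Qed.

Lemma enorm_ge0 n (x : 'cV[R]_n) : 0 <= enorm x.
Proof. exact: sqrtr_ge0. Qed.

Lemma sqr_enorm n (x : 'cV[R]_n) : enorm x ^+ 2 = dot x x.
Proof. by rewrite sqr_sqrtr // dot_ge0. Qed.

Lemma enorm_eq0 n (x : 'cV[R]_n) : enorm x = 0 -> x = 0.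
Proof. by move=> x0; apply: dot_eq0; rewrite -sqr_enorm x0 expr0n. Qed.

Lemma enorm0 n : enorm (0 : 'cV[R]_n) = 0.
Proof. by rewrite /enorm dot0l sqrtr0. Qed.

Lemma enormN n (x : 'cV[R]_n) : enorm (- x) = enorm x.
Proof. by rewrite /enorm !dotlin opprK. Qed.

Lemma enormB n (x y : 'cV[R]_n) : enorm (x - y) = enorm (y - x).
Proof. by rewrite -enormN opprB. Qed.

Lemma enormZ n a (x : 'cV[R]_n) : enorm (a *: x) = `|a| * enorm x.
Proof.
by rewrite /enorm !dotlin mulrA -expr2 sqrtrM ?sqr_ge0 // sqrtr_sqr.
Qed.

Lemma cauchy_schwarz n (x y : 'cV[R]_n) : dot x y <= enorm x * enorm y.
Proof.
have [y0|y0] := eqVneq (dot y y) 0.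
  by rewrite (dot_eq0 y0) dot0r mulr_ge0 // enorm_ge0.
have yy : 0 < dot y y by rewrite lt_neqAle eq_sym y0 dot_ge0.
have [xy|xy] := leP (dot x y) 0.
  by apply: le_trans xy _; rewrite mulr_ge0 // enorm_ge0.
rewrite -(@ler_pXn2r _ 2) // ?nnegrE ?mulr_ge0 ?enorm_ge0 ?(ltW xy) //.
rewrite exprMn !sqr_enorm.
have := dot_ge0 (dot y y *: x - dot x y *: y).
rewrite !dotlin (dotC y x) => h.
have {}h : 0 <= dot y y * (dot x x * dot y y - dot x y ^+ 2).
  by apply: le_trans h _; rewrite le_eqVlt; apply/orP; left; apply/eqP; ring.
by move: h; rewrite pmulr_rge0 // subr_ge0.
Qed.

Lemma norm_cauchy_schwarz n (x y : 'cV[R]_n) : `|dot x y| <= enorm x * enorm y.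
Proof.
rewrite ler_norml cauchy_schwarz andbT.
by have := cauchy_schwarz (- x) y; rewrite dotNl enormN lerNl.
Qed.

Lemma enormD n (x y : 'cV[R]_n) : enorm (x + y) <= enorm x + enorm y.
Proof.
rewrite -(@ler_pXn2r _ 2) // ?nnegrE ?addr_ge0 ?enorm_ge0 //.
rewrite sqr_enorm sqrrD !sqr_enorm !dotlin (dotC y x).
have := cauchy_schwarz x y.
by lra.
Qed.

Lemma enormBD n (x y : 'cV[R]_n) : enorm (x - y) <= enorm x + enorm y.
Proof. by rewrite (le_trans (enormD _ _)) // enormN. Qed.

(** The Frobenius norm serves as an explicit Lipschitz constant of a matrix. *)
Definition frobenius m n (M : 'M[R]_(m, n)) : R :=
  Num.sqrt (\sum_i dot (row i M)^T (row i M)^T).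

Lemma frobenius_ge0 m n (M : 'M[R]_(m, n)) : 0 <= frobenius M.
Proof. exact: sqrtr_ge0. Qed.

Lemma enorm_mulmx m n (M : 'M[R]_(m, n)) x :
  enorm (M *m x) <= frobenius M * enorm x.
Proof.
rewrite -(@ler_pXn2r _ 2) // ?nnegrE ?mulr_ge0 ?enorm_ge0 ?frobenius_ge0 //.
rewrite sqr_enorm exprMn /frobenius sqr_sqrtr; last by rewrite sumr_ge0 // => i _; exact: dot_ge0.
rewrite dotE mulr_suml; apply: ler_sum => i _.
have -> : (M *m x) i 0 = dot (row i M)^T x.
  by rewrite mxE dotE; apply: eq_bigr => j _; rewrite !mxE.
rewrite -!sqr_enorm -expr2 -exprMn -real_normK ?num_real // ler_sqr ?nnegrE //.
  exact: norm_cauchy_schwarz.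
by rewrite mulr_ge0 // enorm_ge0.
Qed.

Lemma coord_le_enorm n (x : 'cV[R]_n) i : `|x i 0| <= enorm x.
Proof.
rewrite -(@ler_pXn2r _ 2) // ?nnegrE ?enorm_ge0 // sqr_enorm dotE.
rewrite real_normK ?num_real // (bigD1 i) //= -expr2 lerDl.
by rewrite sumr_ge0 // => j _; rewrite -expr2 sqr_ge0.
Qed.

Lemma mxnorm_le_enorm n (x : 'cV[R]_n) : `|x| <= enorm x.
Proof.
rewrite [`|x|]/Num.Def.normr /= mx_normrE; apply/bigmax_leP; split=> [|[i j] _] /=.
  exact: enorm_ge0.
by rewrite ord1 coord_le_enorm.
Qed.

Lemma coord_le_mxnorm n (x : 'cV[R]_n) i : `|x i 0| <= `|x|.
Proof.
by rewrite [`|x|]/Num.Def.normr /= mx_normrE; apply: (le_bigmax _ _ (i, 0)).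
Qed.

Lemma enorm_le_mxnorm n (x : 'cV[R]_n) : enorm x <= n%:R * `|x|.
Proof.
rewrite -(@ler_pXn2r _ 2) // ?nnegrE ?mulr_ge0 ?enorm_ge0 //.
rewrite sqr_enorm dotE exprMn.
apply: (@le_trans _ _ (\sum_(i < n) `|x| ^+ 2)).
  apply: ler_sum => i _; rewrite -expr2 -[X in X <= _]real_normK ?num_real //.
  by rewrite ler_sqr ?nnegrE // coord_le_mxnorm.
rewrite sumr_const card_ord -[X in X <= _]mulr_natl ler_wpM2r ?sqr_ge0 //.
by rewrite -natrX ler_nat; case: (n) => // k; rewrite -mulnn leq_pmulr.
Qed.

Lemma pnorm_ge0 m (p : 'cV[R]_m * R) : 0 <= pnorm p.
Proof. exact: sqrtr_ge0. Qed.

Lemma sqr_pnorm m (p : 'cV[R]_m * R) : pnorm p ^+ 2 = enorm p.1 ^+ 2 + p.2 ^+ 2.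
Proof. by rewrite sqr_sqrtr // addr_ge0 ?sqr_ge0. Qed.

Lemma pnorm_fst m (p : 'cV[R]_m * R) : enorm p.1 <= pnorm p.
Proof.
rewrite -(@ler_pXn2r _ 2) // ?nnegrE ?enorm_ge0 ?pnorm_ge0 //.
by rewrite sqr_pnorm lerDl sqr_ge0.
Qed.

Lemma pnorm_snd m (p : 'cV[R]_m * R) : `|p.2| <= pnorm p.
Proof.
rewrite -(@ler_pXn2r _ 2) // ?nnegrE ?pnorm_ge0 //.
by rewrite sqr_pnorm real_normK ?num_real // lerDr sqr_ge0.
Qed.

Lemma pnorm_eq0 m (p : 'cV[R]_m * R) : pnorm p = 0 -> p = 0.
Proof.
move=> p0; have := pnorm_fst p; have := pnorm_snd p; rewrite p0 => a b.
rewrite (surjective_pairing p) (enorm_eq0 (x := p.1)).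
  by move: a; rewrite normr_le0 => /eqP ->.
by apply/eqP; rewrite eq_le b enorm_ge0.
Qed.

Lemma pnorm0 m : pnorm (0 : 'cV[R]_m * R) = 0.
Proof. by rewrite /pnorm enorm0 expr0n addr0 sqrtr0. Qed.

Lemma pnormZ m a (p : 'cV[R]_m * R) : pnorm (a *: p) = `|a| * pnorm p.
Proof.
rewrite /pnorm /= enormZ !exprMn real_normK ?num_real // -mulrDr.
by rewrite sqrtrM ?sqr_ge0 // sqrtr_sqr.
Qed.

Lemma pnorm_le_norm m (p : 'cV[R]_m * R) : pnorm p <= m.+1%:R * `|p|.
Proof.
apply: (@le_trans _ _ (enorm p.1 + `|p.2|)).
  rewrite -(@ler_pXn2r _ 2) // ?nnegrE ?addr_ge0 ?pnorm_ge0 ?enorm_ge0 //.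
  rewrite sqr_pnorm sqrrD real_normK ?num_real // addrAC lerDl.
  by rewrite mulrn_wge0 // mulr_ge0 // enorm_ge0.
rewrite -natr1 mulrDl mul1r lerD //.
  apply: le_trans (enorm_le_mxnorm _) _; rewrite ler_wpM2l //.
  by rewrite prod_normE le_max lexx.
by rewrite prod_normE le_max lexx orbT.
Qed.

End Euclid.

(** * Limits of vectors *)
Section Limits.
Variable R : realType.

Lemma cvg_enormP (T : Type) (F : set_system T) {FF : Filter F} n
    (f : T -> 'cV[R]_n) (x : 'cV[R]_n) :
  f @ F --> x <-> enorm (f t - x) @[t --> F] --> (0 : R).
Proof.
split=> [/cvgrPdist_lt fx|/cvgrPdist_lt fx]; apply/cvgrPdist_lt => e e0.
- have e0' : 0 < e / n.+1%:R by rewrite divr_gt0.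
  apply: filterS (fx _ e0') => t ft.
  rewrite sub0r normrN ger0_norm ?enorm_ge0 // enormB.
  apply: le_lt_trans (enorm_le_mxnorm _) _.
  apply: (@le_lt_trans _ _ (n.+1%:R * `|x - f t|)).
    by rewrite ler_wpM2r // ler_nat.
  by rewrite mulrC -ltr_pdivlMr.
- apply: filterS (fx _ e0) => t.
  rewrite sub0r normrN ger0_norm ?enorm_ge0 // enormB.
  exact/le_lt_trans/mxnorm_le_enorm.
Qed.

Lemma cvg_mulmx (T : Type) (F : set_system T) {FF : Filter F} m n
    (M : 'M[R]_(m, n)) (f : T -> 'cV[R]_n) (x : 'cV[R]_n) :
  f @ F --> x -> M *m f t @[t --> F] --> M *m x.
Proof.
move=> /cvg_enormP fx; apply/cvg_enormP.
apply: (@squeeze_cvgr _ _ _ _ (cst 0) (fun t => frobenius M * enorm (f t - x))).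
- by apply: nearW => t /=; rewrite enorm_ge0 -mulmxBr enorm_mulmx.
- exact: cvg_cst.
- by rewrite -[X in _ --> X](mulr0 (frobenius M)); apply: cvgM fx; exact: cvg_cst.
Qed.

Lemma cvg_coord (T : Type) (F : set_system T) {FF : Filter F} n
    (f : T -> 'cV[R]_n) (x : 'cV[R]_n) i :
  f @ F --> x -> f t i 0 @[t --> F] --> x i 0.
Proof. by move=> fx; exact: (cvg_comp _ _ fx (@coord_continuous _ _ _ i 0 x)). Qed.

Lemma cvg_dot (T : Type) (F : set_system T) {FF : Filter F} n
    (f g : T -> 'cV[R]_n) (x y : 'cV[R]_n) :
  f @ F --> x -> g @ F --> y -> dot (f t) (g t) @[t --> F] --> dot x y.
Proof.
move=> fx gy; rewrite dotE.
under eq_fun do rewrite dotE.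
apply: (@cvg_big R _ +%R 0 xpredT (@add_continuous R) _ F _ (fun i t => f t i 0 * g t i 0)).
by move=> i _; apply: cvgM; exact: cvg_coord.
Qed.

Lemma cvg_enorm (T : Type) (F : set_system T) {FF : Filter F} n
    (f : T -> 'cV[R]_n) (x : 'cV[R]_n) :
  f @ F --> x -> enorm (f t) @[t --> F] --> enorm x.
Proof.
move=> fx; exact: (cvg_comp _ _ (cvg_dot fx fx) (@sqrt_continuous R (dot x x))).
Qed.

Lemma cvg_subseq (phi : nat -> nat) : (forall k, (k <= phi k)%N) ->
  phi k @[k --> \oo] --> \oo.
Proof.
move=> phik A [N _ NA]; exists N => // k /= Nk.
by apply: NA => /=; exact: leq_trans Nk (phik k).
Qed.

(** Asking only k <= phi k, instead of monotonicity, is enough to transfer limits. *)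
Lemma bounded_subsequence n (x : nat -> 'cV[R]_n) (M : R) :
  (forall k, enorm (x k) <= M) ->
  exists (phi : nat -> nat) (l : 'cV[R]_n),
    (forall k, (k <= phi k)%N) /\ x (phi k) @[k --> \oo] --> l.
Proof.
move=> xM.
have cK : compact [set v : 'rV[R]_n | forall i, v ord0 i \in `[- M, M]].
  by apply: (@rV_compact _ _ (fun=> `[- M, M]%classic)) => _; exact: segment_compact.
have [|l [_ cl]] := cK ((fun k => (x k)^T) @ \oo) _.
  exists 0%N => // k _ i /=; rewrite mxE in_itv /= -ler_norml.
  exact: le_trans (coord_le_enorm _ _) (xM k).
have ex k : exists j, (k <= j)%N /\ `|l^T - x j| < k.+1%:R^-1.
  have e0 : 0 < k.+1%:R^-1 :> R by rewrite invr_gt0 ltr0n.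
  have [|_ [[j kj <-] xl]] :=
    cl [set (x j)^T | j in [set j | (k <= j)%N]] _ _ (nbhsx_ballx l _ e0).
    by exists k => // j kj; exists j.
  exists j; split => //; apply: (@le_lt_trans _ _ `|l - (x j)^T|); last first.
    by move: xl; rewrite mx_norm_ball.
  rewrite [X in X <= _]/Num.Def.normr [X in _ <= X]/Num.Def.normr /= !mx_normrE.
  apply/bigmax_leP; split=> [|[i i'] _] /=.
    exact: bigmax_ge_id.
  rewrite ord1; apply: le_trans (le_bigmax _ _ (0, i)) => /=.
  by rewrite !mxE.
have [phi phiP] := choice ex.
exists phi, l^T; split=> [k|]; first by case: (phiP k).
apply/cvgrPdist_lt => e e0.
have := @cvg_harmonic R; move/cvgrPdist_lt => /(_ _ e0); apply: filterS => k.
rewrite sub0r normrN ger0_norm ?harmonic_ge0 // => ke.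
by apply: lt_trans ke; case: (phiP k).
Qed.

(** Bounded difference quotients converge as soon as all their sequential
    limit points satisfy a condition with at most one solution. *)
Lemma cvg_right_unique n (f : R -> 'cV[R]_n) (L : 'cV[R]_n -> Prop) :
  (forall u : nat -> R, (forall k, 0 < u k) -> u k @[k --> \oo] --> (0 : R) ->
     exists (phi : nat -> nat) (l : 'cV[R]_n),
     [/\ forall k, (k <= phi k)%N, f (u (phi k)) @[k --> \oo] --> l & L l]) ->
  (forall l l', L l -> L l' -> l = l') ->
  exists2 l, f t @[t --> 0^'+] --> l & L l.
Proof.
move=> sub uniqL.
have harm_gt0 k : 0 < harmonic k :> R by rewrite /= invr_gt0 ltr0n.
have [phi [l [_ _ Ll]]] := sub _ harm_gt0 (@cvg_harmonic R).
exists l => //; apply/cvgrPdist_lt => e e0; apply: contrapT => nfl.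
have ex k : exists t, [/\ 0 < t, t < harmonic k & e <= `|l - f t|].
  apply: contrapT => nex; apply: nfl; exists (harmonic k); first exact: harm_gt0.
  move=> t /= tk t0; rewrite ltNge; apply/negP => elt; apply: nex; exists t.
  split=> //; apply: le_lt_trans tk; rewrite sub0r normrN ger0_norm // ltW //.
have [u uP] := choice ex.
have [||psi [l' [psik ul Ll']]] := sub u.
- by move=> k; case: (uP k).
- apply: (@squeeze_cvgr _ _ _ _ (cst 0) (@harmonic R)).
  + by apply: nearW => k /=; case: (uP k) => a b _; rewrite !ltW.
  + exact: cvg_cst.
  + exact: cvg_harmonic.
rewrite (uniqL _ _ Ll' Ll) in ul.
move/cvgrPdist_lt : ul => /(_ _ e0) [N _ /(_ N (leqnn N))] /=.
by rewrite ltNge; case: (uP (psi N)) => _ _ ->.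
Qed.

End Limits.

(** * Piecewise linear-quadratic penalties *)
Section Penalty.
Variables (R : realType) (n k : nat) (B : 'M[R]_n) (P : 'M[R]_(n, k)) (beta : 'cV[R]_k).
Hypothesis psdB : psd B.
Let C := polyhedron P beta.
Implicit Types (x y z v d : 'cV[R]_n) (c : R).

Lemma psd_sym x y : dot x (B *m y) = dot y (B *m x).
Proof. by rewrite dot_mulr (proj1 psdB) dotC. Qed.

Lemma in_polyhedron z : C z <-> forall i, dot (col i P) z <= beta i 0.
Proof.
have E i : dot (col i P) z = (P^T *m z) i 0.
  by rewrite dotE mxE; apply: eq_bigr => j _; rewrite !mxE.
by split=> h i; have := h i; rewrite E.
Qed.

Lemma polyhedron_convex z z' t : 0 <= t -> t <= 1 -> C z -> C z' ->
  C (z + t *: (z' - z)).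
Proof.
move=> t0 t1 /in_polyhedron Cz /in_polyhedron Cz'; apply/in_polyhedron => i.
rewrite !dotlin; have := Cz i; have := Cz' i.
set a := dot _ _; set b := dot _ _; set e := beta i 0 => ae be.
have -> : b + t * (a - b) = t * a + (1 - t) * b by ring.
have : t * a <= t * e by rewrite ler_wpM2l.
have : (1 - t) * b <= (1 - t) * e by rewrite ler_wpM2l // subr_ge0.
lra.
Qed.

(** The pairs above the graph of the penalty; working with them keeps the
    convex analysis in the reals although the penalty may be infinite. *)
Definition epi y c := forall z, C z -> dot y z - 2^-1 * dot z (B *m z) <= c.

(** The inclusion of x - B v in the normal cone of the polyhedron at v. *)
Definition vi x v := C v /\ forall z, C z -> dot (x - B *m v) (z - v) <= 0.

Definition dual_value x v := dot x v - 2^-1 * dot v (B *m v).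

Lemma plq_le y c : (plq C B y <= c%:E)%E <-> epi y c.
Proof.
split=> [h z Cz|h].
  rewrite -lee_fin; apply: le_trans h; apply: ereal_sup_ubound.
  by exists z.
by apply: ge_ereal_sup => _ [z Cz <-]; rewrite lee_fin; exact: h.
Qed.

Lemma plq_ge y z : C z -> ((dual_value y z)%:E <= plq C B y)%E.
Proof. by move=> Cz; apply: ereal_sup_ubound; exists z. Qed.

Lemma epi_convex x c y c' t : 0 <= t -> t <= 1 -> epi x c -> epi y c' ->
  epi (x + t *: (y - x)) (c + t * (c' - c)).
Proof.
move=> t0 t1 xc yc z Cz; rewrite !dotlin; have := xc _ Cz; have := yc _ Cz.
set a := dot _ _; set b := _ * dot _ _; set e := dot _ _ => ae be.
have -> : e + t * (a - e) - b = t * (a - b) + (1 - t) * (e - b) by ring.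
have : t * (a - b) <= t * c' by rewrite ler_wpM2l.
have : (1 - t) * (e - b) <= (1 - t) * c by rewrite ler_wpM2l // subr_ge0.
lra.
Qed.

(** Second-order expansion in z of the concave function whose supremum over
    the polyhedron is the penalty. *)
Lemma dual_value_expand x v z : dual_value x z =
  dual_value x v + dot (x - B *m v) (z - v) - 2^-1 * dot (z - v) (B *m (z - v)).
Proof.
rewrite /dual_value !(mulmxDr, mulmxN, dotlin) (psd_sym v z).
have -> : dot (B *m v) z = dot z (B *m v) by rewrite dotC.
have -> : dot (B *m v) v = dot v (B *m v) by rewrite dotC.
by field.
Qed.

Lemma vi_epi x v : vi x v -> epi x (dual_value x v).
Proof.
move=> [_ h] z Cz; rewrite -/(dual_value x z) (dual_value_expand x v).
have := h z Cz; have := (proj2 psdB) (z - v); lra.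
Qed.

Lemma plq_vi x v : vi x v -> plq C B x = (dual_value x v)%:E.
Proof.
move=> xv; apply/eqP; rewrite eq_le plq_ge; last by case: xv.
by rewrite andbT; apply/plq_le/vi_epi.
Qed.

Lemma first_order_ge0 (g a t0 : R) : 0 < t0 ->
  (forall t, 0 < t -> t < t0 -> 0 <= g + t * a) -> 0 <= g.
Proof.
move=> t0_gt0 h; rewrite leNgt; apply/negP => g0.
have a1 : 0 < `|a| + 1 by rewrite ltr_wpDl.
pose t := Num.min (t0 / 2) (- g / (2 * (`|a| + 1))).
have tp : 0 < t.
  by rewrite lt_min !divr_gt0 // ?oppr_gt0 // mulr_gt0.
have tt0 : t < t0.
  by rewrite gt_min ltr_pdivrMr // ltr_pMr // ltr1n.
have ta : t * (2 * (`|a| + 1)) <= - g.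
  by rewrite -ler_pdivlMr ?mulr_gt0 // ge_min lexx orbT.
have : t * a <= t * `|a| by rewrite ler_wpM2l ?ler_norm // ltW.
have : 0 <= t * `|a| by rewrite mulr_ge0 // ltW.
have := h t tp tt0; lra.
Qed.

(** Subgradients at finite points satisfy the variational inequality.
    Moving [x] along a column of [P] keeps [v] feasible, and comparing with the
    point [B v], where the penalty is at most half of <v, B v>, shows that [v]
    attains the supremum that defines the penalty at [x]. *)
Lemma subgradient_vi x c v : epi x c ->
  (forall y c', epi y c' -> c + dot v (y - x) <= c') -> vi x v.
Proof.
move=> xc sub.
have Cv : C v.
  apply/in_polyhedron => i; rewrite leNgt; apply/negP => vi.
  have : epi (x + col i P) (c + beta i 0).
    move=> z Cz; rewrite !dotlin; have := xc z Cz.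
    move/in_polyhedron : Cz => /(_ i); lra.
  by move=> /sub; rewrite addrAC subrr add0r dotC; lra.
have vmax : c <= dual_value x v.
  have : epi (B *m v) (2^-1 * dot v (B *m v)).
    move=> z Cz; have := (proj2 psdB) (z - v).
    rewrite !(mulmxDr, mulmxN, dotlin) (psd_sym v z).
    by rewrite (dotC (B *m v) z); lra.
  move=> /sub; rewrite /dual_value !dotlin (dotC v x); lra.
split=> // z Cz; rewrite -oppr_ge0.
apply: (@first_order_ge0 _ (2^-1 * dot (z - v) (B *m (z - v))) 1) => // t t0 t1.
have := xc _ (polyhedron_convex (ltW t0) (ltW t1) Cv Cz).
rewrite -/(dual_value x _) (dual_value_expand x v).
rewrite [in X in X - _](addrC v) addrK (addrC v) addrK -scalemxAr !dotZr !dotZl => h.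
have {}h := le_trans h vmax.
suff : 0 <= t * (- dot (x - B *m v) (z - v) + t * (2^-1 * dot (z - v) (B *m (z - v)))).
  by rewrite pmulr_rge0.
by lra.
Qed.

Lemma vi_subgradient x v y c : vi x v -> epi y c ->
  dual_value x v + dot v (y - x) <= c.
Proof.
move=> [Cv _] yc; have := yc v Cv; rewrite /dual_value !dotlin (dotC v y) (dotC v x).
lra.
Qed.

Lemma plq_fin_num x c : C !=set0 -> epi x c ->
  exists2 c', plq C B x = c'%:E & c' <= c.
Proof.
move=> [z Cz] /plq_le; have := plq_ge x Cz.
by case: (plq C B x) => [c'| |] //= _ xc; exists c'.
Qed.

Lemma subdiff_plq x v : C !=set0 -> subdiff (plq C B) x v <-> vi x v.
Proof.
move=> C0; split.
- move=> [xfin sub]; pose c := fine (plq C B x).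
  have cE : plq C B x = c%:E by rewrite fineK.
  have xc : epi x c by apply/plq_le; rewrite cE.
  apply: (subgradient_vi xc) => y c' /plq_le yc'.
  by rewrite -lee_fin EFinD -cE; apply: le_trans (sub y) yc'.
- move=> xv; split; first by rewrite (plq_vi xv).
  move=> y; rewrite (plq_vi xv) -EFinD.
  apply: le_trans (plq_ge y (proj1 xv)); rewrite lee_fin /dual_value !dotlin.
  rewrite (dotC v y) (dotC v x); lra.
Qed.

Section LeastSquares.
Variables (m : nat) (A : 'M[R]_(m, n)).
Implicit Types p : 'cV[R]_m * R.

(** The residual scaled by the penalty parameter.  Its image under A^T is the
    subgradient of the penalty selected by the optimality condition. *)
Definition residual p x := p.2^-1 *: (p.1 - A *m x).
Definition dual_point p x := A^T *m residual p x.

Definition fit p x : R := 2^-1 * enorm (A *m x - p.1) ^+ 2.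

Lemma fit_expand p x d : p.2 != 0 ->
  fit p (x + d) = fit p x - p.2 * dot (dual_point p x) d + 2^-1 * dot (A *m d) (A *m d).
Proof.
move=> p0; rewrite /fit /dual_point /residual dot_mull trmxK dotZl mulrA.
rewrite divff // mul1r mulmxDr.
have -> : A *m x + A *m d - p.1 = A *m d - (p.1 - A *m x).
  by rewrite opprB addrA (addrC (A *m d)).
rewrite -(opprB p.1); move: (p.1 - _) => e.
by rewrite !sqr_enorm !dotlin (dotC (A *m d) e); field.
Qed.

Definition is_sol p x := vi x (dual_point p x).

(** By convexity it suffices to compare with points close to x on each segment
    issuing from x; this covers interior minimisers over a ball as well. *)
Lemma local_min_is_sol p x c : 0 < p.2 -> epi x c ->
  (forall y, exists2 t0, 0 < t0 & forall t, 0 < t -> t < t0 -> t <= 1 ->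
    forall c', epi (x + t *: (y - x)) c' ->
      fit p x + p.2 * c <= fit p (x + t *: (y - x)) + p.2 * c') ->
  is_sol p x.
Proof.
move=> p0 xc loc; apply: (subgradient_vi xc) => y c' yc'.
have [t0 t0_gt0 h] := loc y.
suff : 0 <= p.2 * (c' - c - dot (dual_point p x) (y - x)).
  by rewrite pmulr_rge0 //; lra.
apply: (@first_order_ge0 _ (2^-1 * dot (A *m (y - x)) (A *m (y - x)))
  (Num.min t0 1)); first by rewrite lt_min t0_gt0 ltr01.
move=> t t_gt0; rewrite lt_min => /andP[tt0 /ltW t1].
have := h t t_gt0 tt0 t1 _ (epi_convex (ltW t_gt0) t1 xc yc').
rewrite fit_expand ?gt_eqF // -scalemxAr !dotZr !dotZl.
set a := dot _ _; set b := dot _ _ => hh.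
suff : 0 <= t * (p.2 * (c' - c - a) + t * (2^-1 * b)) by rewrite pmulr_rge0.
by lra.
Qed.

Lemma solution_mapP p x : C !=set0 -> 0 < p.2 ->
  solution_map A B P beta p x <-> is_sol p x.
Proof.
move=> C0 p0; rewrite /solution_map /argmin /= -/C; split.
- move=> xmin.
  have e0 : epi 0 0.
    move=> z Cz; rewrite dot0l sub0r oppr_le0 mulr_ge0 //; exact: (proj2 psdB).
  have [c0 c0E _] := plq_fin_num C0 e0.
  have [c cE] : exists c, plq C B x = c%:E.
    have := xmin 0; rewrite c0E.
    case: C0 => z Cz; have := plq_ge x Cz.
    case: (plq C B x) => [c _ _| _|//]; first by exists c.
    by rewrite mulry gtr0_sg // mul1e.
  have xc : epi x c by apply/plq_le; rewrite cE.
  apply: (local_min_is_sol p0 xc) => y; exists 1 => // t _ _ _ c'.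
  move=> /(plq_fin_num C0)[c''].
  set y' := _ + _ => c''E c''c'; have := xmin y'.
  rewrite -/(fit p x) -/(fit p y') cE c''E -!EFinM -!EFinD lee_fin => h.
  by apply: le_trans h _; rewrite lerD2l ler_pM2l.
- move=> xv y; rewrite (plq_vi xv) -/(fit p x) -/(fit p y).
  case E : (plq C B y) => [c'| |].
  + have yc' : epi y c' by apply/plq_le; rewrite E.
    have := vi_subgradient xv yc'.
    rewrite -!EFinM -!EFinD lee_fin -[in fit p y](subrK x y) (addrC _ x).
    rewrite fit_expand ?gt_eqF // => h.
    have := dot_ge0 (A *m (y - x)).
    have : p.2 * (dual_value x (dual_point p x) + dot (dual_point p x) (y - x)) <= p.2 * c'.
      by rewrite ler_pM2l.
    lra.
  + by rewrite mulry gtr0_sg // mul1e leey.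
  + by have := plq_ge y (proj1 xv); rewrite E.
Qed.

End LeastSquares.
End Penalty.

(** * The span of the active constraint normals *)
Section ActiveSpan.
Variables (R : realType) (n k : nat) (P : 'M[R]_(n, k)) (beta : 'cV[R]_k).
Implicit Types (x y v d : 'cV[R]_n).

(** Inactive columns are zeroed rather than removed, so that the index type of
    the coordinates does not depend on v. *)
Definition active_mx v : 'M[R]_(n, k) :=
  \matrix_(i, j) if j \in active P beta v then P i j else 0.

Lemma active_mx_mul v c :
  active_mx v *m c = \sum_(i in active P beta v) c i 0 *: col i P.
Proof.
apply/colP => j; rewrite mxE summxE [RHS]big_mkcond /=; apply: eq_bigr => i _.
by rewrite mxE; case: ifP => _; rewrite ?mul0r // !mxE mulrC.
Qed.

Lemma active_mx_tr_mul v d :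
  (active_mx v)^T *m d = 0 <->
  forall i, i \in active P beta v -> dot (col i P) d = 0.
Proof.
have E i : ((active_mx v)^T *m d) i 0 =
    if i \in active P beta v then dot (col i P) d else 0.
  rewrite mxE.
  case: ifP => iv.
    by rewrite dotE; apply: eq_bigr => j _; rewrite !mxE iv.
  by rewrite big1 // => j _; rewrite !mxE iv mul0r.
split=> [h i iv|h]; first by have := E i; rewrite h mxE iv.
by apply/colP => i; rewrite E mxE; case: ifP => // /h.
Qed.

(** Double orthogonality in finite dimension. *)
Lemma sub_active_mxP v x :
  (exists c, x = active_mx v *m c) <->
  forall d, (forall i, i \in active P beta v -> dot (col i P) d = 0) -> dot x d = 0.
Proof.
split=> [[c ->] d|h].
  by move/active_mx_tr_mul => h; rewrite dot_mull h dot0r.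
have : (x^T <= (active_mx v)^T)%MS.
  rewrite submxE; apply/eqP/rowP => j; rewrite [RHS]mxE.
  have -> : (x^T *m cokermx (active_mx v)^T) 0 j = dot x (col j (cokermx (active_mx v)^T)).
    by rewrite dotE mxE; apply: eq_bigr => i _; rewrite !mxE.
  apply/h/active_mx_tr_mul.
  by rewrite colE mulmxA mulmx_coker mul0mx.
case/submxP => c xc; exists c^T.
by rewrite -[x]trmxK xc trmx_mul trmxK.
Qed.

Lemma active_spanP v x :
  x \in active_span P beta v <->
  forall d, (forall i, i \in active P beta v -> dot (col i P) d = 0) -> dot x d = 0.
Proof.
split=> [|/sub_active_mxP[c ->]].
- rewrite /active_span => xs d h.
  set X := [seq _ | _ <- _] in xs.
  have /coord_span -> : x \in <<in_tuple X>>%VS by [].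
  rewrite (dot_suml _ _ (fun i => coord (in_tuple X) i x) (fun i => (in_tuple X)`_i)).
  rewrite big1 // => i _.
  have /mapP[j jv ->] : (in_tuple X)`_i \in X by apply: mem_nth.
  by rewrite h ?mulr0 //; move: jv; rewrite mem_enum.
- rewrite active_mx_mul; apply: memv_suml => i iv; apply: memvZ; apply: memv_span.
  by apply: map_f; rewrite mem_enum.
Qed.

Lemma active_span_mul v x :
  x \in active_span P beta v <-> exists c, x = active_mx v *m c.
Proof. by rewrite sub_active_mxP active_spanP. Qed.

(** The norm of the left inverse is the constant that converts estimates of A x
    into estimates of x. *)
Lemma left_inverse_on_span m (A : 'M[R]_(m, n)) v :
  mx_ker A `&` [set x | x \in active_span P beta v] = [set 0] ->
  exists D : 'M[R]_(n, m), forall x, x \in active_span P beta v -> x = D *m (A *m x).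
Proof.
move=> crit; set Q := active_mx v.
have : (Q <= A *m Q)%MS.
  rewrite submxE; apply/eqP/matrixP => i j.
  pose d := col j (cokermx (A *m Q)).
  have Qd : (mx_ker A `&` [set x | x \in active_span P beta v]) (Q *m d).
    split; last by apply/active_span_mul; exists d.
    by rewrite /mx_ker /= mulmxA /d colE mulmxA mulmx_coker mul0mx.
  rewrite crit /= in Qd.
  by have := congr1 (fun z : 'cV_n => z i 0) Qd; rewrite /d colE mulmxA -colE mxE => ->; rewrite !mxE.
case/submxP => D QD; exists D => x /active_span_mul[c ->].
by rewrite !mulmxA -(mulmxA D A) -QD.
Qed.

(** Coordinates on the span can be chosen linearly in x, so they are bounded by a
    multiple of its norm. *)
Lemma span_dot_bound v : exists2 K : R, 0 <= K &
  forall x y, x \in active_span P beta v ->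
  dot x y <= K * enorm x * \sum_(i in active P beta v) `|dot (col i P) y|.
Proof.
set Q := active_mx v; pose M := (pinvmx Q^T)^T.
exists (frobenius M); first exact: frobenius_ge0.
move=> x y xv; have xE : x = Q *m (M *m x).
  have : (x^T <= Q^T)%MS.
    move/active_span_mul : xv => [c ->].
    by apply/submxP; exists c^T; rewrite trmx_mul.
  move/mulmxKpV => /(congr1 trmx).
  by rewrite (trmx_mul (x^T *m _)) (trmx_mul x^T) !trmxK => /esym.
rewrite {1}xE active_mx_mul dot_suml mulr_sumr; apply: ler_sum => i _.
apply: le_trans (ler_norm _) _; rewrite normrM ler_wpM2r //.
exact: le_trans (coord_le_enorm _ _) (enorm_mulmx _ _).
Qed.

Lemma finite_lower_bound (F : 'I_k -> R) : (forall i, 0 < F i) ->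
  exists2 e, 0 < e & forall i, e <= F i.
Proof.
move=> F0; exists (\big[Order.min/1]_i F i); last by move=> i; exact: bigmin_le.
by apply/bigmin_gtP; split.
Qed.

Lemma activeE v i : (i \in active P beta v) = (dot (col i P) v == beta i 0).
Proof. by rewrite inE. Qed.

(** The weights absorb the size of p_i in active_near and that of <p_i, d> in
    feasible_step. *)
Lemma inactive_slack v (c : 'I_k -> R) : polyhedron P beta v -> (forall i, 0 <= c i) ->
  exists2 e : R, 0 < e & forall i, i \notin active P beta v ->
    e * (c i + 1) <= beta i 0 - dot (col i P) v.
Proof.
move=> Cv c0; pose slack i := beta i 0 - dot (col i P) v.
pose F i := (if slack i == 0 then 1 else slack i) / (c i + 1).
have c1 i : 0 < c i + 1 by rewrite ltr_wpDl.
have slack_ge0 i : 0 <= slack i by rewrite subr_ge0; move/in_polyhedron : Cv; apply.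
have [e e0 eF] : exists2 e, 0 < e & forall i, e <= F i.
  apply: finite_lower_bound => i; rewrite divr_gt0 //.
  by case: eqVneq => // s0; rewrite lt_neqAle eq_sym s0 slack_ge0.
exists e => // i; rewrite activeE eq_sym -subr_eq0 -/(slack i) => si.
by have := eF i; rewrite /F (negbTE si) ler_pdivlMr.
Qed.

Lemma active_near v : polyhedron P beta v ->
  exists2 e : R, 0 < e & forall v', enorm (v' - v) < e ->
    active P beta v' \subset active P beta v.
Proof.
move=> Cv.
have [e e0 he] := inactive_slack Cv (fun i => enorm_ge0 (col i P)).
exists e => // v' v'e; apply/fintype.subsetP => i; rewrite activeE => /eqP v'i.
apply/negPn/negP => /he h.
have E : beta i 0 - dot (col i P) v = dot (col i P) (v' - v) by rewrite !dotlin v'i.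
have := cauchy_schwarz (col i P) (v' - v).
have : enorm (v' - v) * (enorm (col i P) + 1) < e * (enorm (col i P) + 1).
  by rewrite ltr_pM2r // ltr_wpDl // enorm_ge0.
have := enorm_ge0 (v' - v).
lra.
Qed.

Lemma feasible_step v d : polyhedron P beta v ->
  (forall i, i \in active P beta v -> dot (col i P) d <= 0) ->
  exists2 t0 : R, 0 < t0 & forall t, 0 <= t -> t <= t0 -> polyhedron P beta (v + t *: d).
Proof.
move=> Cv vd.
have [e e0 he] := inactive_slack Cv (fun i => normr_ge0 (dot (col i P) d)).
exists e => // t t0 te; apply/in_polyhedron => i; rewrite !dotlin.
have [iv|/he h] := boolP (i \in active P beta v).
  have : t * dot (col i P) d <= 0 by rewrite mulr_ge0_le0 // vd.
  by move: iv; rewrite activeE => /eqP; lra.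
have : t * dot (col i P) d <= t * `|dot (col i P) d| by rewrite ler_wpM2l // ler_norm.
have : t * (`|dot (col i P) d| + 1) <= e * (`|dot (col i P) d| + 1).
  by rewrite ler_wpM2r // addr_ge0.
lra.
Qed.

Variable B : 'M[R]_n.

(** Feasible directions have a nonpositive product with normals; applied
    to opposite directions this places normals in the span of the active p_i. *)
Lemma vi_le0 x v d : vi B P beta x v ->
  (forall i, i \in active P beta v -> dot (col i P) d <= 0) ->
  dot (x - B *m v) d <= 0.
Proof.
move=> [Cv h] vd; have [t t0 ht] := feasible_step Cv vd.
have := h _ (ht t (ltW t0) (lexx _)); rewrite addrAC subrr add0r dotZr.
by rewrite pmulr_rle0.
Qed.

Lemma vi_orth x v d : vi B P beta x v ->
  (forall i, i \in active P beta v -> dot (col i P) d = 0) ->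
  dot (x - B *m v) d = 0.
Proof.
move=> xv vd; apply/eqP; rewrite eq_le; apply/andP; split.
  by apply: (vi_le0 xv) => i /vd ->.
rewrite -oppr_le0 -dotNr; apply: (vi_le0 xv) => i /vd.
by rewrite dotNr => ->; rewrite oppr0.
Qed.

Lemma vi_in_span x v w : vi B P beta x v ->
  active P beta v \subset active P beta w ->
  x - B *m v \in active_span P beta w.
Proof.
move=> xv /fintype.subsetP sub; apply/active_spanP => d wd; apply: (vi_orth xv) => i /sub.
exact: wd.
Qed.

(** As x moves along B d, the normal x - B v stays the same; being orthogonal to
    d, it is still normal at the shifted point. *)
Lemma vi_shift x v d : vi B P beta x v ->
  (forall i, i \in active P beta v -> dot (col i P) d = 0) ->
  exists2 t0 : R, 0 < t0 & forall t, `|t| <= t0 ->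
    vi B P beta (x + t *: (B *m d)) (v + t *: d).
Proof.
move=> xv vd; have Cv := proj1 xv.
have [|t1 t10 h1] := @feasible_step v d Cv; first by move=> i /vd ->.
have [|t2 t20 h2] := @feasible_step v (- d) Cv.
  by move=> i /vd; rewrite dotNr => ->; rewrite oppr0.
exists (Num.min t1 t2); first by rewrite lt_min t10.
move=> t; rewrite le_min => /andP[tt1 tt2]; split.
  have [t0|t0] := leP 0 t; first by apply: h1 => //; rewrite -(ger0_norm t0).
  rewrite -[t *: d]opprK -scaleNr -scalerN; apply: h2; first by rewrite oppr_ge0 ltW.
  by rewrite -(ltr0_norm t0).
move=> z Cz; rewrite mulmxDr -scalemxAr opprD addrACA subrr addr0.
have := (proj2 xv) z Cz; have := vi_orth xv vd.
rewrite !opprD !dotDr !dotNr !dotZr => ->; lra.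
Qed.

End ActiveSpan.

(** * Local behaviour of the solution map *)
Section Local.
Variables (R : realType) (m n k : nat) (A : 'M[R]_(m, n)) (B : 'M[R]_n)
  (P : 'M[R]_(n, k)) (beta : 'cV[R]_k).
Hypothesis psdB : psd B.
Implicit Types (p : 'cV[R]_m * R) (x y v d : 'cV[R]_n).

Lemma vi_monotone x1 v1 x2 v2 : vi B P beta x1 v1 -> vi B P beta x2 v2 ->
  dot (B *m (v1 - v2)) (v1 - v2) <= dot (x1 - x2) (v1 - v2).
Proof.
move=> [C1 h1] [C2 h2]; have := h1 _ C2; have := h2 _ C1.
rewrite !(mulmxDr, mulmxN, dotlin); lra.
Qed.

Lemma scale_residual p x : p.2 != 0 -> p.2 *: residual A p x = p.1 - A *m x.
Proof. by move=> p0; rewrite /residual scalerA divff // scale1r. Qed.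

Lemma image_difference p1 p2 x1 x2 : p1.2 != 0 -> p2.2 != 0 ->
  A *m (x1 - x2) = ((p1.1 - p2.1) - (p1.2 - p2.2) *: residual A p2 x2) -
    p1.2 *: (residual A p1 x1 - residual A p2 x2).
Proof.
move=> p10 p20; rewrite scalerBr scalerBl !scale_residual // mulmxBr.
move: (A *m x1) (A *m x2) (p1.2 *: _) => a1 a2 a3.
by apply/colP => i; rewrite !mxE; ring.
Qed.

(** Monotonicity of the subdifferential bounds the residuals, and with them A x;
    passing from A x to x is where the criterion enters. *)
Lemma residual_lipschitz p1 p2 x1 x2 : 0 < p1.2 -> 0 < p2.2 ->
  is_sol B P beta A p1 x1 -> is_sol B P beta A p2 x2 ->
  p1.2 * enorm (residual A p1 x1 - residual A p2 x2) <=
  enorm ((p1.1 - p2.1) - (p1.2 - p2.2) *: residual A p2 x2).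
Proof.
move=> p10 p20 s1 s2; set r1 := residual A p1 x1; set r2 := residual A p2 x2.
set e := _ - _ *: r2; set dr := r1 - r2.
have dxE : A *m (x1 - x2) = e - p1.2 *: dr by apply: image_difference; rewrite gt_eqF.
have mon : 0 <= dot (A *m (x1 - x2)) dr.
  rewrite dot_mull /dr mulmxBr; apply: le_trans (vi_monotone s1 s2).
  by rewrite dotC; exact: (proj2 psdB).
have [->|dr0] := eqVneq (enorm dr) 0; first by rewrite mulr0 enorm_ge0.
have dr_gt0 : 0 < enorm dr by rewrite lt_neqAle eq_sym dr0 enorm_ge0.
rewrite -(ler_pM2r dr_gt0) -mulrA -expr2 sqr_enorm.
apply: le_trans (cauchy_schwarz e dr).
by move: mon; rewrite dxE !dotlin; lra.
Qed.

Lemma perturbation_bound p1 p2 (r : 'cV[R]_m) :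
  enorm ((p1.1 - p2.1) - (p1.2 - p2.2) *: r) <= pnorm (p1 - p2) * (1 + enorm r).
Proof.
apply: le_trans (enormBD _ _) _; rewrite mulrDr mulr1 lerD //.
  exact: (pnorm_fst (p1 - p2)).
by rewrite enormZ ler_wpM2r ?enorm_ge0 // (pnorm_snd (p1 - p2)).
Qed.

Variables (bbar : 'cV[R]_m) (lbar : R) (xbar : 'cV[R]_n).
Hypothesis lbar_gt0 : 0 < lbar.
Let pbar := (bbar, lbar).
Hypothesis xbar_sol : is_sol B P beta A pbar xbar.
Let rbar := residual A pbar xbar.
Let vbar := dual_point A pbar xbar.
Let cbar := dual_value B xbar vbar.
Hypothesis criterion :
  mx_ker A `&` [set x | x \in active_span P beta vbar] = [set 0].

Lemma half_lt p : `|p - pbar| <= lbar / 2 -> lbar / 2 <= p.2.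
Proof.
have : `|p.2 - lbar| <= `|p - pbar| by rewrite [X in _ <= X]prod_normE le_max lexx orbT.
move=> h1 h2; have := le_trans h1 h2; rewrite ler_norml => /andP[]; lra.
Qed.

Lemma near_pbar (e : R) : 0 < e -> exists2 delta : R, 0 < delta &
  forall p, `|p - pbar| < delta ->
    lbar / 2 <= p.2 /\ pnorm (p - pbar) * (1 + enorm rbar) < e * p.2.
Proof.
move=> e0; have K0 : 0 < m.+1%:R * (1 + enorm rbar).
  by rewrite mulr_gt0 // ltr_pwDl // enorm_ge0.
exists (Num.min (lbar / 2) (e * (lbar / 2) / (m.+1%:R * (1 + enorm rbar)))).
  by rewrite lt_min !divr_gt0 // !mulr_gt0 // invr_gt0.
move=> p; rewrite lt_min => /andP[/ltW/half_lt lp]; rewrite ltr_pdivlMr // => h.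
split => //; apply: (@lt_le_trans _ _ (e * (lbar / 2))); last by rewrite ler_pM2l.
apply: le_lt_trans h; rewrite mulrA ler_wpM2r //.
  by rewrite addr_ge0 // enorm_ge0.
by rewrite mulrC pnorm_le_norm.
Qed.

(** The residual estimate keeps the dual point of any solution close to vbar,
    where the inactive constraints have slack. *)
Lemma near_active : exists2 delta : R, 0 < delta & forall p, `|p - pbar| < delta ->
  lbar / 2 <= p.2 /\ forall x, is_sol B P beta A p x ->
    enorm (residual A p x) <= 1 + enorm rbar /\
    active P beta (dual_point A p x) \subset active P beta vbar.
Proof.
have [e e0 he] := active_near (proj1 xbar_sol).
have F0 : 0 < frobenius A^T + 1 by rewrite ltr_wpDl // frobenius_ge0.
have [|delta d0 hd] := @near_pbar (Num.min 1 (e / (frobenius A^T + 1))).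
  by rewrite lt_min ltr01 divr_gt0.
exists delta => // p /hd[lp pp]; split => // x xs.
have p0 : 0 < p.2 by apply: lt_le_trans lp; rewrite divr_gt0.
have h : enorm (residual A p x - rbar) < Num.min 1 (e / (frobenius A^T + 1)).
  rewrite -(ltr_pM2l p0) [X in _ < X]mulrC; apply: le_lt_trans pp.
  apply: le_trans (@residual_lipschitz p pbar x xbar p0 lbar_gt0 xs xbar_sol) _.
  exact: perturbation_bound.
move: h; rewrite lt_min => /andP[h1 h2]; split.
  rewrite -[residual A p x](subrK rbar); apply: le_trans (enormD _ _) _.
  by rewrite lerD2r ltW.
apply: he; rewrite /vbar /dual_point -mulmxBr.
apply: le_lt_trans (enorm_mulmx _ _) _; move: h2; rewrite ltr_pdivlMr //.
by have := enorm_ge0 (residual A p x - rbar); lra.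
Qed.

Lemma near_lipschitz : exists delta kappa : R, [/\ 0 < delta, 0 <= kappa,
  forall p, `|p - pbar| < delta -> lbar / 2 <= p.2,
  forall p x, `|p - pbar| < delta -> is_sol B P beta A p x ->
    active P beta (dual_point A p x) \subset active P beta vbar &
  forall p1 p2 x1 x2, `|p1 - pbar| < delta -> `|p2 - pbar| < delta ->
    is_sol B P beta A p1 x1 -> is_sol B P beta A p2 x2 ->
    enorm (x1 - x2) <= kappa * pnorm (p1 - p2)].
Proof.
have [delta d0 hd] := near_active.
have [D HD] := left_inverse_on_span criterion.
pose c := 2 + enorm rbar.
have c0 : 0 <= c by rewrite addr_ge0 // enorm_ge0.
pose K := frobenius (D *m (A *m B)) + frobenius B.
have K0 : 0 <= K by rewrite addr_ge0 // frobenius_ge0.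
exists delta, (frobenius D * (2 * c) + K * (frobenius A^T * (c / (lbar / 2)))).
have lb2 : 0 < lbar / 2 by rewrite divr_gt0.
split=> //.
- by rewrite addr_ge0 // !mulr_ge0 // ?frobenius_ge0 // invr_ge0 ltW.
- by move=> p /hd[].
- by move=> p x /hd[_ h] /h[].
move=> p1 p2 x1 x2 /hd[l1 h1] /hd[l2 h2] s1 s2.
have [_ a1] := h1 _ s1; have [r2 a2] := h2 _ s2.
have p10 := lt_le_trans lb2 l1; have p20 := lt_le_trans lb2 l2.
set dp := pnorm (p1 - p2); have dp0 : 0 <= dp := pnorm_ge0 _.
set dr := residual A p1 x1 - residual A p2 x2.
set e := (p1.1 - p2.1) - (p1.2 - p2.2) *: residual A p2 x2.
have eB : enorm e <= dp * c.
  apply: le_trans (perturbation_bound _ _ _) _; rewrite ler_wpM2l // /c.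
  by have := r2; lra.
have drB : p1.2 * enorm dr <= enorm e := residual_lipschitz p10 p20 s1 s2.
have drB' : enorm dr <= c / (lbar / 2) * dp.
  rewrite mulrAC ler_pdivlMr // mulrC (mulrC c).
  apply: le_trans eB; apply: le_trans drB; by rewrite ler_wpM2r ?enorm_ge0.
pose dv := dual_point A p1 x1 - dual_point A p2 x2.
have dvE : dv = A^T *m dr by rewrite /dv /dual_point mulmxBr.
have AdxB : enorm (A *m (x1 - x2)) <= 2 * c * dp.
  have -> : A *m (x1 - x2) = e - p1.2 *: dr by apply: image_difference; rewrite gt_eqF.
  apply: le_trans (enormBD _ _) _; rewrite enormZ gtr0_norm //.
  by have := le_trans drB eB; move: eB; lra.
have dvB : enorm dv <= frobenius A^T * (c / (lbar / 2)) * dp.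
  rewrite dvE; apply: le_trans (enorm_mulmx _ _) _; rewrite -mulrA.
  by rewrite ler_wpM2l // frobenius_ge0.
have inW : (x1 - x2) - B *m dv \in active_span P beta vbar.
  have -> : (x1 - x2) - B *m dv = (x1 - B *m dual_point A p1 x1) -
      (x2 - B *m dual_point A p2 x2).
    rewrite /dv mulmxBr; move: (B *m _) (B *m _) => b1 b2.
    by apply/colP => i; rewrite !mxE; ring.
  by rewrite memvB // vi_in_span.
(* D recovers the part of x1 - x2 in the span from its image under A. *)
have dxE : x1 - x2 = D *m (A *m (x1 - x2)) - D *m (A *m B) *m dv + B *m dv.
  rewrite -!mulmxA -mulmxBr -mulmxBr -HD // subrK //.
rewrite dxE; apply: le_trans (enormD _ _) _.
apply: le_trans (lerD (enormBD _ _) (enorm_mulmx _ _)) _.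
have t1 := le_trans (enorm_mulmx D (A *m (x1 - x2))) (ler_wpM2l (frobenius_ge0 D) AdxB).
have t2 := enorm_mulmx (D *m (A *m B)) dv.
have t3 : K * enorm dv <= K * (frobenius A^T * (c / (lbar / 2)) * dp) by rewrite ler_wpM2l.
rewrite /K in t3 *; lra.
Qed.

Lemma cbar_epi : epi B P beta xbar cbar.
Proof. exact: vi_epi. Qed.

(** Uniqueness of the minimiser makes the objective, even with a smaller
    quadratic part, exceed its minimum uniformly on a sphere.  The coefficient
    1 / (4 lbar) is a lower bound for 1 / (2 lambda) as long as lambda <= 2 lbar. *)
Lemma sphere_growth : exists2 e : R, 0 < e &
  forall y c, enorm (y - xbar) = 1 -> epi B P beta y c ->
  e <= c - cbar - dot vbar (y - xbar) +
       (4 * lbar)^-1 * dot (A *m (y - xbar)) (A *m (y - xbar)).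
Proof.
apply: contrapT => no.
have ex j : exists yc : 'cV[R]_n * R, [/\ enorm (yc.1 - xbar) = 1,
    epi B P beta yc.1 yc.2 & yc.2 - cbar - dot vbar (yc.1 - xbar) +
    (4 * lbar)^-1 * dot (A *m (yc.1 - xbar)) (A *m (yc.1 - xbar)) < harmonic j].
  apply: contrapT => nex; apply: no; exists (harmonic j); first by rewrite /= invr_gt0 ltr0n.
  move=> y c y1 yc; rewrite leNgt; apply/negP => h; apply: nex.
  by exists (y, c).
have [yc ycP] := choice ex.
have [|phi [y [phik yl]]] := @bounded_subsequence R n (fun j => (yc j).1) (1 + enorm xbar).
  move=> j; rewrite -[(yc j).1](subrK xbar); apply: le_trans (enormD _ _) _.
  by case: (ycP j) => -> _ _.
have dl : (yc (phi j)).1 - xbar @[j --> \oo] --> y - xbar.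
  by apply: cvgB => //; exact: cvg_cst.
have y1 : enorm (y - xbar) = 1.
  have hl := [elaborate cvg_enorm dl].
  apply/eqP; rewrite eq_le; apply/andP; split.
    by apply: (cvgr_to_le hl); apply: nearW => j; case: (ycP (phi j)) => ->.
  by apply: (cvgr_to_ge hl); apply: nearW => j; case: (ycP (phi j)) => ->.
set q := (4 * lbar)^-1 * dot (A *m (y - xbar)) (A *m (y - xbar)).
have yq : epi B P beta y (cbar + dot vbar (y - xbar) - q).
  move=> z Cz; rewrite -subr_ge0.
  have hl : harmonic (phi j) - (dot (yc (phi j)).1 z - 2^-1 * dot z (B *m z) - cbar
     - dot vbar ((yc (phi j)).1 - xbar) + (4 * lbar)^-1 *
       dot (A *m ((yc (phi j)).1 - xbar)) (A *m ((yc (phi j)).1 - xbar))) @[j --> \oo]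
    --> 0 - (dot y z - 2^-1 * dot z (B *m z) - cbar - dot vbar (y - xbar) + q).
    apply: cvgB.
      exact: (cvg_comp _ _ (cvg_subseq phik) (@cvg_harmonic R)).
    apply: cvgD.
      apply: cvgB; last by apply: cvg_dot => //; exact: cvg_cst.
      apply: cvgB; last exact: cvg_cst.
      apply: cvgB; last exact: cvg_cst.
      by apply: cvg_dot => //; exact: cvg_cst.
    apply: cvgM; first exact: cvg_cst.
    by apply: cvg_dot; apply: cvg_mulmx.
  suff : 0 <= 0 - (dot y z - 2^-1 * dot z (B *m z) - cbar - dot vbar (y - xbar) + q).
    lra.
  apply: (cvgr_to_ge hl); apply: nearW => j; have [_ epij /ltW] := ycP (phi j).
  have := epij z Cz; lra.
have sub := vi_subgradient xbar_sol yq.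
have Ad0 : A *m (y - xbar) = 0.
  apply: dot_eq0; apply/eqP; rewrite eq_le dot_ge0 andbT.
  have l0 : 0 < (4 * lbar)^-1 by rewrite invr_gt0 mulr_gt0.
  by rewrite -(ler_pM2l l0) mulr0 -/q; move: sub; rewrite -/vbar -/cbar; lra.
have vy : dual_point A pbar y = vbar.
  rewrite /vbar /dual_point /residual -[in LHS](subrK xbar y).
  by rewrite (mulmxDr A) Ad0 add0r.
have ys : is_sol B P beta A pbar y.
  rewrite /is_sol vy; move: yq; rewrite /q Ad0 dot0r mulr0 subr0 => yq.
  apply: (subgradient_vi psdB yq) => y' c' y'c'.
  have := vi_subgradient xbar_sol y'c'; rewrite -/vbar -/cbar !dotlin; lra.
have [delta [kappa [d0 _ _ _ lip]]] := near_lipschitz.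
have pb : `|pbar - pbar| < delta by rewrite subrr normr0.
have := lip _ _ _ _ pb pb ys xbar_sol; rewrite y1 subrr pnorm0 mulr0.
by rewrite ler10.
Qed.

(** The minimum over a ball is attained: the infimum is approached by pairs above
    the graph, and lower semicontinuity holds because the penalty is a supremum
    of continuous functions. *)
Lemma ball_minimiser p : 0 < p.2 -> exists x c, [/\ enorm (x - xbar) <= 1,
  epi B P beta x c & forall y c', enorm (y - xbar) <= 1 -> epi B P beta y c' ->
  fit A p x + p.2 * c <= fit A p y + p.2 * c'].
Proof.
move=> p0.
pose E := [set s | exists y c, [/\ enorm (y - xbar) <= 1, epi B P beta y c &
  s = fit A p y + p.2 * c]].
have Einf : has_inf E.
  split.
    exists (fit A p xbar + p.2 * cbar), xbar, cbar; split => //.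
      by rewrite subrr enorm0.
    exact: cbar_epi.
  exists (p.2 * (cbar - enorm vbar)) => _ [y [c [y1 yc ->]]].
  apply: ler_wpDl; first by rewrite mulr_ge0 // sqr_ge0.
  rewrite ler_pM2l //; apply: le_trans (vi_subgradient xbar_sol yc).
  rewrite -/vbar -/cbar lerD2l -lerNl; have := cauchy_schwarz (- vbar) (y - xbar).
  rewrite dotNl enormN => /le_trans; apply.
  by rewrite ler_piMr // enorm_ge0.
pose s := inf E.
have ex j : exists yc : 'cV[R]_n * R, [/\ enorm (yc.1 - xbar) <= 1,
    epi B P beta yc.1 yc.2 & fit A p yc.1 + p.2 * yc.2 < s + harmonic j].
  have h0 : 0 < harmonic j :> R by rewrite /= invr_gt0 ltr0n.
  have [_ [y [c [y1 yc ->]]] h] := inf_adherent h0 Einf.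
  by exists (y, c).
have [yc ycP] := choice ex.
have [|phi [x [phik xl]]] := @bounded_subsequence R n (fun j => (yc j).1) (1 + enorm xbar).
  move=> j; rewrite -[(yc j).1](subrK xbar); apply: le_trans (enormD _ _) _.
  by rewrite lerD2r; case: (ycP j).
have dl : (yc (phi j)).1 - xbar @[j --> \oo] --> x - xbar.
  by apply: cvgB => //; exact: cvg_cst.
have fl : fit A p (yc (phi j)).1 @[j --> \oo] --> fit A p x.
  rewrite /fit sqr_enorm; under eq_fun do rewrite sqr_enorm.
  apply: cvgM; first exact: cvg_cst.
  by apply: cvg_dot; apply: cvgB; [exact: cvg_mulmx|exact: cvg_cst|exact: cvg_mulmx|exact: cvg_cst].
exists x, ((s - fit A p x) / p.2); split.
- have nl := [elaborate cvg_enorm dl].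
  by apply: (cvgr_to_le nl); apply: nearW => j /=; case: (ycP (phi j)).
- move=> z Cz; rewrite ler_pdivlMr // -subr_ge0.
  have hl : harmonic (phi j) + (s - fit A p (yc (phi j)).1 -
      (dot (yc (phi j)).1 z - 2^-1 * dot z (B *m z)) * p.2) @[j --> \oo]
    --> 0 + (s - fit A p x - (dot x z - 2^-1 * dot z (B *m z)) * p.2).
    apply: cvgD; first exact: (cvg_comp _ _ (cvg_subseq phik) (@cvg_harmonic R)).
    apply: cvgB; first by apply: cvgB fl; exact: cvg_cst.
    apply: cvgM; last exact: cvg_cst.
    by apply: cvgB; [apply: cvg_dot => //; exact: cvg_cst | exact: cvg_cst].
  rewrite add0r in hl; apply: (cvgr_to_ge hl); apply: nearW => j.
  have [_ epij h] := ycP (phi j).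
  have := epij z Cz; rewrite -(ler_pM2r p0); move: h; lra.
- move=> y c' y1 yc'; rewrite mulrC divfK ?gt_eqF // addrC subrK.
  by apply: ge_inf; [case: Einf | exists y, c'].
Qed.

(** The minimiser over the unit ball around xbar cannot lie on the sphere, where
    the growth of the reference objective outweighs the perturbation. *)
Lemma sol_exists : exists2 delta : R, 0 < delta & forall p, `|p - pbar| < delta ->
  exists x, is_sol B P beta A p x.
Proof.
have [e e0 he] := sphere_growth.
have F0 : 0 < frobenius A^T + 1 by rewrite ltr_wpDl // frobenius_ge0.
have [|delta d0 hd] := @near_pbar (e / (frobenius A^T + 1)).
  by rewrite divr_gt0.
exists (Num.min delta lbar); first by rewrite lt_min d0.
move=> p; rewrite lt_min => /andP[/hd[lp pp] plb].
have p0 : 0 < p.2 by apply: lt_le_trans lp; rewrite divr_gt0.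
have p2 : p.2 <= 2 * lbar.
  have : `|p.2 - lbar| <= `|p - pbar| by rewrite [X in _ <= X]prod_normE le_max lexx orbT.
  move=> /le_lt_trans/(_ plb); rewrite ltr_norml => /andP[_]; lra.
have [x [c [x1 xc xmin]]] := ball_minimiser p0.
exists x; have {}x1 : enorm (x - xbar) < 1.
  rewrite lt_neqAle x1 andbT; apply/eqP => x1'.
  have := xmin xbar cbar; rewrite subrr enorm0 => /(_ ler01 cbar_epi).
  rewrite -[in fit A p x](subrK xbar x) (addrC _ xbar) fit_expand ?gt_eqF //.
  have := he x c x1' xc.
  set d := x - xbar in x1' *; set q := dot (A *m d) (A *m d) => h1 h2.
  have q0 : 0 <= q := dot_ge0 _.
  set vp := dual_point A p xbar in h2.
  have vpE : p.2 *: (vp - vbar) = A^T *m ((p.1 - pbar.1) - (p.2 - pbar.2) *: rbar).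
    rewrite /vp /vbar /dual_point -mulmxBr scalemxAr; congr (_ *m _).
    rewrite scalerBr scalerBl !scale_residual ?gt_eqF // -/rbar.
    move: (A *m xbar) (p.2 *: rbar) => b1 b3.
    by apply/colP => i; rewrite !mxE; ring.
  have vpB : p.2 * enorm (vp - vbar) < p.2 * e.
    rewrite -[in X in X < _](gtr0_norm p0) -enormZ vpE.
    apply: le_lt_trans (enorm_mulmx _ _) _.
    have := le_lt_trans (perturbation_bound p pbar rbar) pp.
    rewrite mulrAC ltr_pdivlMr //.
    set w := enorm _ ; have : 0 <= w := enorm_ge0 _; lra.
  have cs := cauchy_schwarz (vp - vbar) d; rewrite x1' mulr1 in cs.
  have {}cs : p.2 * dot (vp - vbar) d < p.2 * e.
    by apply: le_lt_trans vpB; rewrite ler_pM2l.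
  have h3 : p.2 * e <= p.2 * (c - cbar - dot vbar d + (4 * lbar)^-1 * q) by rewrite ler_pM2l.
  have h4 : p.2 * (4 * lbar)^-1 * q <= 2^-1 * q.
    rewrite ler_wpM2r // ler_pdivrMr ?mulr_gt0 //; move: p2; lra.
  move: cs h2; rewrite dotDl dotNl; lra.
apply: (local_min_is_sol psdB p0 xc) => y.
have y0 : 0 < enorm (y - x) + 1 by rewrite ltr_wpDl // enorm_ge0.
exists ((1 - enorm (x - xbar)) / (enorm (y - x) + 1)).
  by rewrite divr_gt0 // subr_gt0.
move=> t t0; rewrite ltr_pdivlMr // => tt _ c'; apply: xmin.
rewrite addrAC; apply: le_trans (enormD _ _) _; rewrite enormZ gtr0_norm //.
move: tt; lra.
Qed.

End Local.

(** * Directional derivatives *)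
Section DirectionalCondition.
Variables (R : realType) (m n k : nat) (A : 'M[R]_(m, n)) (B : 'M[R]_n)
  (P : 'M[R]_(n, k)) (beta : 'cV[R]_k).
Hypothesis psdB : psd B.
Implicit Types (p : 'cV[R]_m * R) (x y v d xi : 'cV[R]_n) (w : 'cV[R]_m) (lam : R).

(** The rate of change of the dual point, and below of the normal x - B v, when x
    moves with velocity xi and the data with effective velocity w. *)
Definition dual_rate lam w xi : 'cV[R]_n := lam^-1 *: (A^T *m (w - A *m xi)).
Definition normal_rate lam w xi : 'cV[R]_n := xi - B *m dual_rate lam w xi.

(** Changing lambda acts on v like changing b by a multiple of the residual. *)
Definition effective p x (d : 'cV[R]_m * R) : 'cV[R]_m := d.1 - d.2 *: residual A p x.

(** The critical cone of the polyhedron at [v] for the normal [y]. *)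
Definition critical v y d : Prop :=
  (forall i, i \in active P beta v -> dot (col i P) d <= 0) /\ dot y d = 0.

(** Complementarity form of the inclusion of the normal rate in the normal cone
    of the critical cone at the dual rate. *)
Definition linearised p x (d : 'cV[R]_m * R) xi : Prop :=
  let v := dual_point A p x in
  let w := effective p x d in
  [/\ critical v (x - B *m v) (dual_rate p.2 w xi),
      dot (normal_rate p.2 w xi) (dual_rate p.2 w xi) = 0 &
      forall e, critical v (x - B *m v) e -> dot (normal_rate p.2 w xi) e <= 0].

(** A limit of difference quotients inherits the linearised inclusion from the
    variational inequalities at the two points, each tested at the other point
    and at a feasible step. *)
Lemma quotient_limit p x (d : 'cV[R]_m * R) xi (u : nat -> R) (xis : nat -> 'cV[R]_n) :
  0 < p.2 -> is_sol B P beta A p x ->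
  (forall j, 0 < u j) -> u j @[j --> \oo] --> (0 : R) ->
  (forall j, 0 < (p + u j *: d).2) ->
  (forall j, is_sol B P beta A (p + u j *: d) (x + u j *: xis j)) ->
  xis j @[j --> \oo] --> xi ->
  linearised p x d xi.
Proof.
move=> p0 xs u0 ul pu0 us xil.
set v := dual_point A p x in xs *; set w := effective p x d.
rewrite /linearised -/v -/w; set y := x - B *m v.
pose nu j := dual_rate (p + u j *: d).2 w (xis j).
pose mu j := xis j - B *m nu j.
have vE j : dual_point A (p + u j *: d) (x + u j *: xis j) = v + u j *: nu j.
  have pj0 := pu0 j; set pj := p + _ in pj0 *.
  rewrite /v /nu /dual_rate /dual_point scalemxAr [u j *: (_ *m _)]scalemxAr -mulmxDr.
  congr (_ *m _); apply: (scalerI (lt0r_neq0 pj0)).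
  rewrite scale_residual ?lt0r_neq0 // scalerDr.
  rewrite [pj.2 *: (u j *: _)]scalerA (mulrC pj.2) -scalerA [pj.2 *: (pj.2^-1 *: _)]scalerA.
  rewrite divff ?lt0r_neq0 // scale1r.
  rewrite /w /effective -/pj; have -> : pj.2 = p.2 + u j * d.2 by [].
  have -> : pj.1 = p.1 + u j *: d.1 by [].
  rewrite scalerDl (scale_residual A _ (lt0r_neq0 p0)) mulmxDr -scalemxAr -scalerA.
  move: (A *m x) (A *m xis j) (residual A p x) => a1 a2 a3.
  by apply/colP => i; rewrite !mxE; ring.
have yE j : (x + u j *: xis j) - B *m (v + u j *: nu j) = y + u j *: mu j.
  rewrite /y /mu mulmxDr -scalemxAr scalerBr.
  move: (B *m v) (B *m nu j) => a1 a2.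
  by apply/colP => i; rewrite !mxE; ring.
have {us}us j : polyhedron P beta (v + u j *: nu j) /\ forall z, polyhedron P beta z ->
    dot (y + u j *: mu j) (z - (v + u j *: nu j)) <= 0.
  by have := us j; rewrite /is_sol vE => -[Cj hj]; split => // z /hj; rewrite yE.
have nul : nu j @[j --> \oo] --> dual_rate p.2 w xi.
  apply: cvgZ; last first.
    by apply: cvg_mulmx; apply: cvgB; [exact: cvg_cst | exact: cvg_mulmx].
  apply: cvgV; first exact: lt0r_neq0.
  rewrite -[X in _ --> X](addr0 p.2) -(mul0r d.2).
  by apply: cvgD; [exact: cvg_cst | apply: cvgM => //; exact: cvg_cst].
have mul : mu j @[j --> \oo] --> normal_rate p.2 w xi.
  by apply: cvgB => //; exact: cvg_mulmx.
have [Cv hv] := xs; rewrite -/y in hv.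
clear yE vE xs; clearbody y mu nu.
have nu_le0 j : dot y (nu j) <= 0.
  have := hv _ (proj1 (us j)); rewrite addrAC subrr add0r dotZr.
  by rewrite pmulr_rle0.
have nu_ge0 j : 0 <= dot y (nu j) + u j * dot (mu j) (nu j).
  have := (proj2 (us j)) _ Cv; rewrite opprD addrA subrr add0r dotNr dotZr oppr_le0.
  by rewrite pmulr_rge0 // !dotlin.
have crit : critical v y (dual_rate p.2 w xi).
  split.
    move=> i iv; have dl := [elaborate cvg_dot (cvg_cst (col i P)) nul].
    apply: (cvgr_to_le dl); apply: nearW => j.
    have /in_polyhedron/(_ i) := proj1 (us j); rewrite !dotlin.
    move: iv; rewrite activeE => /eqP ->.
    by rewrite gerDl pmulr_rle0.
  have dl := [elaborate cvg_dot (cvg_cst y) nul].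
  apply/eqP; rewrite eq_le; apply/andP; split.
    by apply: (cvgr_to_le dl); apply: nearW.
  have dl2 := [elaborate cvgD dl (cvgM ul (cvg_dot mul nul))].
  rewrite mul0r addr0 in dl2; apply: (cvgr_to_ge dl2); exact: nearW.
(* Test the inequality at the perturbed point with the feasible point v + t e
   for a fixed t: the error is quadratic in u j. *)
have polar e : critical v y e -> dot (normal_rate p.2 w xi) e <= 0.
  move=> [ev ye]; have [t t0 ht] := feasible_step Cv ev.
  have Ct := ht t (ltW t0) (lexx _).
  have dl := [elaborate cvgB (cvgM (cvg_cst t) (cvg_dot mul (cvg_cst e)))
    (cvgM ul (cvg_dot mul nul))].
  rewrite -(pmulr_rle0 _ t0); suff : t * dot (normal_rate p.2 w xi) e -
    0 * dot (normal_rate p.2 w xi) (dual_rate p.2 w xi) <= 0 by rewrite mul0r subr0.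
  apply: (cvgr_to_le dl); apply: nearW => j; rewrite /=.
  have := (proj2 (us j)) _ Ct; have := nu_le0 j; have uj := u0 j.
  rewrite !dotlin ye => a1.
  have {a1} a2 : u j * dot y (nu j) <= 0 by rewrite pmulr_rle0.
  move=> a3; suff : u j * (t * dot (mu j) e - u j * dot (mu j) (nu j)) <= 0.
    by rewrite pmulr_rle0.
  by lra.
split => //; apply/eqP; rewrite eq_le polar //.
have dl := [elaborate cvg_dot mul nul].
apply: (cvgr_to_ge dl); apply: nearW => j.
have := nu_ge0 j; have := nu_le0 j => a b.
rewrite -(pmulr_rge0 _ (u0 j)); lra.
Qed.

(** A direction orthogonal to the active normals is critical together with its
    opposite. *)
Lemma linearised_in_span p x (d : 'cV[R]_m * R) xi v : is_sol B P beta A p x ->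
  active P beta (dual_point A p x) \subset active P beta v ->
  linearised p x d xi ->
  normal_rate p.2 (effective p x d) xi \in active_span P beta v.
Proof.
move=> xs /fintype.subsetP sub [_ _ polar]; apply/active_spanP => e ev.
have ec : forall i, i \in active P beta (dual_point A p x) -> dot (col i P) e = 0.
  by move=> i /sub; exact: ev.
have ye := vi_orth xs ec.
apply/eqP; rewrite eq_le; apply/andP; split.
  by apply: polar; split => // i /ec ->.
rewrite -oppr_le0 -dotNr; apply: polar; split; last by rewrite dotNr ye oppr0.
by move=> i /ec; rewrite dotNr => ->; rewrite oppr0.
Qed.

(** The linearised inclusion is again monotone, so the argument for uniqueness of
    solutions applies to it. *)
Lemma linearised_unique p x (d : 'cV[R]_m * R) xi xi' v : 0 < p.2 -> is_sol B P beta A p x ->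
  active P beta (dual_point A p x) \subset active P beta v ->
  mx_ker A `&` [set z | z \in active_span P beta v] = [set 0] ->
  linearised p x d xi -> linearised p x d xi' -> xi = xi'.
Proof.
move=> p0 xs sub crit l l'.
have s := linearised_in_span xs sub l; have s' := linearised_in_span xs sub l'.
case: l l' => c1 o1 n1 [c2 o2 n2].
set w := effective p x d in s s' c1 o1 n1 c2 o2 n2.
have h1 := n1 _ c2; have h2 := n2 _ c1.
pose e := xi - xi'.
have dE : dual_rate p.2 w xi - dual_rate p.2 w xi' = - (p.2^-1 *: (A^T *m (A *m e))).
  rewrite /dual_rate -scalerBr -mulmxBr -[in RHS]scalerN -[in RHS]mulmxN /e; congr (_ *: (_ *m _)).
  rewrite mulmxBr; move: (A *m xi) (A *m xi') => a1 a2.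
  by apply/colP => i; rewrite !mxE; ring.
have nE : normal_rate p.2 w xi - normal_rate p.2 w xi' =
    e - B *m (dual_rate p.2 w xi - dual_rate p.2 w xi').
  rewrite /normal_rate mulmxBr /e; move: (B *m _) (B *m _) => a1 a2.
  by apply/colP => i; rewrite !mxE; ring.
have mon : 0 <= dot (normal_rate p.2 w xi - normal_rate p.2 w xi')
    (dual_rate p.2 w xi - dual_rate p.2 w xi').
  move: o1 o2 h1 h2; move: (normal_rate _ _ xi) (normal_rate _ _ xi').
  move: (dual_rate _ _ xi) (dual_rate _ _ xi') => nu nu' mu mu'.
  by rewrite !dotlin; lra.
have Ae : A *m e = 0.
  apply: dot_eq0; apply/eqP; rewrite eq_le dot_ge0 andbT.
  have lp : 0 < p.2^-1 by rewrite invr_gt0.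
  rewrite -(pmulr_rle0 _ lp).
  have := (proj2 psdB) (dual_rate p.2 w xi - dual_rate p.2 w xi').
  move: mon; rewrite nE dotDl dotNl [dot (B *m _) _]dotC.
  rewrite [X in dot e X]dE dotNr dotZr -dot_mull.
  by move: (_ * dot _ _) (dot _ (B *m _)) => a b; lra.
have d0 : dual_rate p.2 w xi - dual_rate p.2 w xi' = 0.
  by rewrite dE Ae mulmx0 scaler0 oppr0.
have eW : e \in active_span P beta v.
  by have := memvB s s'; rewrite nE d0 mulmx0 subr0.
have : (mx_ker A `&` [set z | z \in active_span P beta v]) e by [].
by rewrite crit => /eqP; rewrite subr_eq0 => /eqP.
Qed.

Lemma H_mx_mul lam x : H_mx A B lam *m x = x + lam^-1 *: (B *m (A^T *m (A *m x))).
Proof. by rewrite /H_mx mulmxDl mul1mx -scalemxAl !mulmxA. Qed.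

(** A kernel vector x of H equals - B A^T A x / lambda; pairing it with A^T A x
    gives A x = 0, hence x = 0. *)
Lemma H_mx_unit lam : 0 < lam -> H_mx A B lam \in unitmx.
Proof.
move=> l0; have li : 0 < lam^-1 by rewrite invr_gt0.
suff inj x : H_mx A B lam *m x = 0 -> x = 0.
  rewrite -unitmx_tr -row_free_unit -kermx_eq0; apply/eqP/row_matrixP => i.
  rewrite row0; apply: trmx_inj; rewrite trmx0; apply: inj.
  apply: trmx_inj; rewrite trmx_mul trmxK trmx0.
  by rewrite -row_mul mulmx_ker row0.
rewrite H_mx_mul => Hx; pose z := A^T *m (A *m x).
have xE : x = - (lam^-1 *: (B *m z)) by apply/eqP; rewrite -addr_eq0 Hx.
have Ax : A *m x = 0.
  apply: dot_eq0; apply/eqP; rewrite eq_le dot_ge0 andbT dot_mull -/z xE dotNl dotZl.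
  by rewrite oppr_le0 pmulr_rge0 // dotC; exact: (proj2 psdB).
by rewrite xE /z Ax !mulmx0 scaler0 oppr0.
Qed.

(** With mu and nu the normal and the dual part, H (xi - H^-1 B A^T w / lam) = mu.
    One column suffices for U, the normalised H^-1 mu: then H U is parallel to
    mu, and the orthogonality of mu and nu is the normal equation that the
    bracket in the closed formula solves. *)
Lemma sensitivity_representation v lam w xi : 0 < lam ->
  mx_ker A `&` [set z | z \in active_span P beta v] = [set 0] ->
  normal_rate lam w xi \in active_span P beta v ->
  dot (normal_rate lam w xi) (dual_rate lam w xi) = 0 ->
  exists (r : nat) (U : 'M[R]_(n, r)),
    [/\ U^T *m U = 1%:M, (r <= #|active P beta v|)%N,
        gram_mx A (H_mx A B lam) U \in unitmx &
        xi = sensitivity_mx A B lam U *m w].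
Proof.
move=> l0 crit muW ort; set mu := normal_rate lam w xi in muW ort.
set H := H_mx A B lam; have Hu : H \in unitmx := H_mx_unit l0.
pose G0 := lam^-1 *: (invmx H *m B *m A^T).
pose y := xi - G0 *m w.
have Hy : H *m y = mu.
  rewrite /y mulmxBr /G0 -scalemxAl -scalemxAr -!mulmxA (mulKVmx Hu) H_mx_mul.
  rewrite /mu /normal_rate /dual_rate mulmxBr -scalemxAr mulmxBr.
  move: (B *m _) (B *m _) => a1 a2.
  by apply/colP => i; rewrite !mxE; ring.
have xiE : xi = G0 *m w + y by rewrite /y addrC subrK.
have [mu0|mu0] := eqVneq mu 0.
  have y0 : y = 0 by rewrite -(mulKmx Hu y) Hy mu0 mulmx0.
  exists 0%N, 0; split => //.
  - by apply/matrixP => -[].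
  - by rewrite unitmxE det_mx00 unitr1.
  - by rewrite /sensitivity_mx !mul0mx addr0 -/H -/G0 xiE y0 addr0.
have y_neq0 : y != 0 by apply: contra_neq mu0 => y0; rewrite -Hy y0 mulmx0.
have a_neq0 : enorm y != 0 by apply: contra_neq y_neq0 => /enorm_eq0.
have aV_neq0 : (enorm y)^-1 != 0 by rewrite invr_eq0.
pose U : 'cV[R]_n := (enorm y)^-1 *: y.
have yU : y = U *m (enorm y)%:M by rewrite mul_mx_scalar /U scalerA divff // scale1r.
have mx11 (z z' : 'cV[R]_n) : z^T *m z' = (dot z z')%:M by rewrite [LHS]mx11_scalar.
(* The pairing is |A y|^2 plus a nonnegative term, so its vanishing would put
   y = mu in the kernel of A and in the span. *)
have gram_neq0 : dot (A *m mu) (A *m y) != 0.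
  apply/eqP => g0.
  have li : 0 < lam^-1 by rewrite invr_gt0.
  pose z := A^T *m (A *m y).
  have Ay : A *m y = 0.
    apply: dot_eq0; apply/eqP; rewrite eq_le dot_ge0 andbT.
    have : dot (A *m mu) (A *m y) = dot (A *m y) (A *m y) + lam^-1 * dot z (B *m z).
      rewrite -Hy H_mx_mul -/z mulmxDr dotDl -scalemxAr dotZl.
      by rewrite [dot (A *m (B *m z)) _]dot_mull -/z (dotC (B *m z)).
    have : 0 <= lam^-1 * dot z (B *m z) by rewrite pmulr_rge0 //; exact: (proj2 psdB).
    by rewrite g0; lra.
  have muy : mu = y by rewrite -Hy H_mx_mul Ay !mulmx0 scaler0 addr0.
  have : (mx_ker A `&` [set z | z \in active_span P beta v]) y.
    by split => //; rewrite /= -muy.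
  by rewrite crit; exact/eqP.
have AHU : A *m H *m U = (enorm y)^-1 *: (A *m mu).
  by rewrite /U -scalemxAr -mulmxA Hy.
have gu : gram_mx A H U \in unitmx.
  rewrite /gram_mx AHU -[A *m U]scalemxAr unitmxE det_mx11 unitfE.
  rewrite -/(dot ((enorm y)^-1 *: (A *m mu)) ((enorm y)^-1 *: (A *m y))).
  by rewrite dotZl dotZr !mulf_neq0.
exists 1%N, U; split => //.
- rewrite mx11 /U dotZl dotZr -sqr_enorm expr2 mulKf // mulVf //.
- rewrite lt0n; apply: contra mu0 => /eqP/eqP; rewrite cards_eq0 => /eqP a0.
  move/active_span_mul : muW => [c ->]; rewrite active_mx_mul a0 big_set0 //.
- rewrite /sensitivity_mx -/H -/G0 xiE mulmxDl; congr (_ + _).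
  rewrite -!mulmxA mulmxBl mul1mx -(mulmxA A).
  have -> : w - A *m (G0 *m w) = (w - A *m xi) + A *m y.
    by rewrite /y mulmxBr addrA subrK.
  rewrite mulmxDr.
  have -> : (A *m (H *m U))^T *m (w - A *m xi) = 0.
    rewrite mulmxA AHU; apply/matrixP => i j; rewrite !ord1 [RHS]mxE.
    rewrite -/(dot ((enorm y)^-1 *: (A *m mu)) (w - A *m xi)).
    rewrite dotZl dot_mull; move: ort; rewrite /dual_rate dotZr => /eqP.
    by rewrite mulf_eq0 invr_eq0 gt_eqF //= => /eqP ->; rewrite mulr0.
  have Ay : A *m y = A *m U *m (enorm y)%:M by rewrite -mulmxA -yU.
  rewrite add0r Ay (mulmxA _ (A *m U)).
  rewrite [(A *m (H *m U))^T *m (A *m U)](_ : _ = gram_mx A H U); last first.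
    by rewrite /gram_mx (mulmxA A H U).
  by rewrite (mulKmx gu) -yU.
Qed.

End DirectionalCondition.

(** * From directional derivatives to the Lipschitz modulus *)
Section MeanValue.
Variable R : realType.

(** One-sided mean value inequality: the set of times up to which the bound
    holds is closed by continuity and can always be extended to the right. *)
Lemma right_mean_value (phi : R -> R) (l K M : R) : 0 <= l ->
  (forall a b, 0 <= a -> a <= b -> b <= l -> phi b <= phi a + K * (b - a)) ->
  (forall t, 0 <= t -> t < l -> exists2 h0, 0 < h0 &
     forall h, 0 < h -> h < h0 -> phi (t + h) <= phi t + M * h) ->
  phi l <= phi 0 + M * l.
Proof.
move=> l0 lipK right.
pose T := [set t | [/\ 0 <= t, t <= l & forall r, 0 <= r -> r <= t -> phi r <= phi 0 + M * r]].
have T0 : T 0.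
  split => // r r0 r0'; have -> : r = 0 by apply/eqP; rewrite eq_le r0'.
  by rewrite mulr0 addr0.
have supT : has_sup T by split; [exists 0|exists l => t []].
pose c := sup T.
have c0 : 0 <= c by apply: sup_upper_bound.
have cl : c <= l by apply: ge_sup => [|t []]; first by exists 0.
have Tc : T c.
  split => // r r0 rc.
  apply/ler_addgt0Pr => e e0.
  have K0 : 0 < `|K| + `|M| + 1 by rewrite ltr_wpDl // addr_ge0.
  have [t [t0 tl tT] ct] := sup_adherent (divr_gt0 e0 K0) supT.
  have [rt|/ltW tr] := leP r t; first by apply: le_trans (tT r r0 rt) _; rewrite lerDl ltW.
  have := lipK t r t0 tr (le_trans rc cl); have := tT t t0 (lexx _).
  have ht : (r - t) * (`|K| + `|M| + 1) <= e.
    rewrite -ler_pdivlMr //; rewrite -/c in ct; lra.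
  have h1 : K * (r - t) <= `|K| * (r - t) by rewrite ler_wpM2r ?subr_ge0 // ler_norm.
  have h2 : - M * (r - t) <= `|M| * (r - t).
    by rewrite ler_wpM2r ?subr_ge0 // -normrN ler_norm.
  have h3 : 0 <= r - t by rewrite subr_ge0.
  lra.
have [_ _ cT] := Tc.
have [<-|cl'] := eqVneq c l; first exact: cT.
have {}cl' : c < l by rewrite lt_neqAle cl'.
have [h0 h00 hh] := right c c0 cl'.
pose t := Num.min (c + h0 / 2) l.
have ct : c < t by rewrite lt_min cl' andbT ltrDl divr_gt0.
have : T t.
  split; first exact: le_trans c0 (ltW ct); first by rewrite ge_min lexx orbT.
  move=> r r0 rt; have [rc|cr] := leP r c; first exact: cT.
  have := hh (r - c); rewrite subr_gt0 => /(_ cr).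
  have -> : c + (r - c) = r by rewrite addrC subrK.
  have rh : r - c < h0.
    have : t <= c + h0 / 2 by rewrite ge_min lexx.
    lra.
  by move=> /(_ rh); have := cT c c0 (lexx _); lra.
by move=> /(sup_upper_bound supT); rewrite -/c leNgt ct.
Qed.

Lemma near_ballP m (p : 'cV[R]_m * R) (Q : set ('cV[R]_m * R)) :
  (\forall q \near p, Q q) <->
  exists2 e : R, 0 < e & forall q, `|q - p| < e -> Q q.
Proof.
split.
  move=> /nbhs_ballP[e e0 h]; exists e => // q qe; apply: h.
  by rewrite -ball_normE /ball_ /= distrC.
move=> [e e0 h]; apply/nbhs_ballP; exists e => // q.
by rewrite -ball_normE /ball_ /= distrC; exact: h.
Qed.

Lemma near_pairP m (p : 'cV[R]_m * R) (e : R) (Q : set (('cV[R]_m * R) * ('cV[R]_m * R))) :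
  0 < e -> (forall q q', `|q - p| < e -> `|q' - p| < e -> Q (q, q')) ->
  \forall qq \near (p, p), Q qq.
Proof.
move=> e0 h; exists ([set q | `|q - p| < e], [set q | `|q - p| < e]).
  by split; apply/near_ballP; exists e.
by move=> [q q'] [] /=; exact: h.
Qed.

Lemma segment_in_ball m (p q q' : 'cV[R]_m * R) (e th : R) :
  0 <= th -> th <= 1 -> `|q - p| < e -> `|q' - p| < e ->
  `|q + th *: (q' - q) - p| < e.
Proof.
move=> th0 th1 qe qe'.
have -> : q + th *: (q' - q) - p = (1 - th) *: (q - p) + th *: (q' - p).
  rewrite scalerBl scale1r -[RHS]addrA (addrC (- _)) -scalerBr opprB addrA subrK.
  by rewrite addrAC.
apply: le_lt_trans (ler_normD _ _) _; rewrite !normrZ (ger0_norm th0).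
rewrite ger0_norm ?subr_ge0 //.
have [->|th_neq0] := eqVneq th 0; first by rewrite subr0 mul1r mul0r addr0.
have th_gt0 : 0 < th by rewrite lt_neqAle eq_sym th_neq0.
have : th * `|q' - p| < th * e by rewrite ltr_pM2l.
have : (1 - th) * `|q - p| <= (1 - th) * e by rewrite ler_wpM2l ?subr_ge0 // ltW.
lra.
Qed.

Lemma cvg_scaled_quotient m n (f : 'cV[R]_m * R -> 'cV[R]_n) (p d : 'cV[R]_m * R) l (M : R) :
  dir_quotient f p d t @[t --> 0^'+] --> l -> enorm l < M ->
  exists2 h0 : R, 0 < h0 & forall h, 0 < h -> h < h0 ->
    enorm (f (p + h *: d) - f p) <= M * h.
Proof.
move=> /cvg_enorm ql lM.
have /cvgr_lt/(_ _ lM) [h0 h00 hh] := ql _.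
exists h0 => // h hp hh0; have := hh h.
rewrite /= sub0r normrN gtr0_norm // => /(_ hh0 hp).
by rewrite /dir_quotient enormZ gtr0_norm ?invr_gt0 // mulrC ltr_pdivrMr // => /ltW.
Qed.

(** The one-sided mean value inequality is applied to the distance from the value
    at one endpoint, along the segment, which stays in the ball by convexity. *)
Lemma lipschitz_from_derivatives m n (f : 'cV[R]_m * R -> 'cV[R]_n) (p : 'cV[R]_m * R) (r K M : R) :
  (forall q q', `|q - p| < r -> `|q' - p| < r ->
     enorm (f q - f q') <= K * pnorm (q - q')) ->
  (forall q d, `|q - p| < r -> pnorm d = 1 -> exists2 l,
     dir_quotient f q d t @[t --> 0^'+] --> l & enorm l <= M) ->
  forall q q', `|q - p| < r -> `|q' - p| < r ->
     enorm (f q - f q') <= M * pnorm (q - q').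
Proof.
move=> lipK der q q' qr qr'; set l := pnorm (q - q').
have [l0|l_neq0] := eqVneq l 0.
  by rewrite l0 mulr0; have := lipK _ _ qr qr'; rewrite -/l l0 mulr0.
have l_gt0 : 0 < l by rewrite lt_neqAle eq_sym l_neq0 pnorm_ge0.
pose d := l^-1 *: (q - q').
have d1 : pnorm d = 1 by rewrite /d pnormZ ger0_norm ?invr_ge0 ?pnorm_ge0 // mulVf.
have inball t : 0 <= t -> t <= l -> `|q' + t *: d - p| < r.
  move=> t0 tl; rewrite /d scalerA; apply: segment_in_ball => //.
    by rewrite divr_ge0 // ltW.
  by rewrite ler_pdivrMr // mul1r.
pose phi t := enorm (f (q' + t *: d) - f q').
have qE : q' + l *: d = q by rewrite /d scalerA divff // scale1r addrC subrK.
have tri a b : phi b <= phi a + enorm (f (q' + b *: d) - f (q' + a *: d)).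
  have := enormD (f (q' + b *: d) - f (q' + a *: d)) (f (q' + a *: d) - f q').
  by rewrite addrA subrK /phi (addrC (enorm _)).
apply/ler_addgt0Pr => e e0.
have -> : f q - f q' = f (q' + l *: d) - f q' by rewrite qE.
rewrite -/(phi l).
have -> : M * l + e = phi 0 + (M + e / l) * l.
  by rewrite /phi scale0r addr0 subrr enorm0 add0r mulrDl divfK.
apply: (@right_mean_value _ _ K) => [|a b a0 ab bl|t t0 tl]; first exact: ltW.
  apply: le_trans (tri a b) _; rewrite lerD2l.
  have := lipK _ _ (inball b (le_trans a0 ab) bl) (inball a a0 (le_trans ab bl)).
  rewrite opprD addrACA subrr add0r -scalerBl pnormZ d1 mulr1.
  by rewrite ger0_norm ?subr_ge0.
have [xi ql xiM] := der _ _ (inball t t0 (ltW tl)) d1.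
have [|h0 h00 hh] := cvg_scaled_quotient (M := M + e / l) ql.
  by apply: le_lt_trans xiM _; rewrite ltrDl divr_gt0.
exists h0 => // h hp hh0; apply: le_trans (tri t (t + h)) _; rewrite lerD2l.
by have := hh h hp hh0; rewrite -addrA -scalerDl.
Qed.

(** Every neighbourhood that enters the upper limit contains a ball, on which the
    corresponding supremum is a Lipschitz constant. *)
Lemma lipschitz_modulus_le m n (f : 'cV[R]_m * R -> 'cV[R]_n) (p : 'cV[R]_m * R) (r K : R) : 0 < r ->
  (forall q q', `|q - p| < r -> `|q' - p| < r ->
     enorm (f q - f q') <= K * pnorm (q - q')) ->
  (forall q d, `|q - p| < r -> dir_quotient f q d t @[t --> 0^'+] --> dir_derivative f q d) ->
  (lipschitz_modulus f p <= limf_esup (max_dir_derivative f) (nbhs p))%E.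
Proof.
move=> r0 lipK der; apply: le_ereal_inf_tmp => _ [V /near_ballP[e e0 Ve] <-].
pose r' := Num.min r e; have r'0 : 0 < r' by rewrite lt_min r0.
have r'r q : `|q - p| < r' -> `|q - p| < r by rewrite lt_min => /andP[].
have r'e q : `|q - p| < r' -> V q by rewrite lt_min => /andP[_]; exact: Ve.
set M := ereal_sup _.
have derM q d : `|q - p| < r' -> pnorm d <= 1 -> ((enorm (dir_derivative f q d))%:E <= M)%E.
  move=> qr d1; apply: (@le_trans _ _ (max_dir_derivative f q)).
    by apply: ereal_sup_ubound; exists d.
  by apply: ereal_sup_ubound; exists q => //; exact: r'e.
have := derM p 0; rewrite subrr normr0 pnorm0 => /(_ r'0 ler01).
case ME : M => [M'| |] // _; last by rewrite leey.
have lipM : forall q q', `|q - p| < r' -> `|q' - p| < r' ->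
     enorm (f q - f q') <= M' * pnorm (q - q').
  apply: (@lipschitz_from_derivatives _ _ _ _ _ K).
    by move=> q q' /r'r qr /r'r qr'; exact: lipK.
  move=> q d qr d1; exists (dir_derivative f q d); first by apply: der; exact: r'r.
  by rewrite -lee_fin -ME derM // d1.
pose W := [set qq : ('cV[R]_m * R) * ('cV[R]_m * R) |
  [/\ qq.1 <> qq.2, `|qq.1 - p| < r' & `|qq.2 - p| < r']].
apply: (@le_trans _ _ (ereal_sup [set ((enorm (f qq.1 - f qq.2) / pnorm (qq.1 - qq.2))%:E) | qq in W])).
  apply: ereal_inf_lbound; exists W => //.
  by apply: (near_pairP r'0) => q q' qr qr' /=.
apply: ge_ereal_sup => _ [[q q'] [/= neq qr qr'] <-]; rewrite lee_fin.
have pn : 0 < pnorm (q - q').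
  rewrite lt_neqAle pnorm_ge0 andbT eq_sym; apply/eqP => /pnorm_eq0/eqP.
  by rewrite subr_eq0 => /eqP.
by rewrite ler_pdivrMr //; exact: lipM.
Qed.

Lemma max_dir_derivative_le m n (f : 'cV[R]_m * R -> 'cV[R]_n) (p : 'cV[R]_m * R) (K : R) :
  (forall d, enorm (dir_derivative f p d) <= K * pnorm d) -> 0 <= K ->
  (max_dir_derivative f p <= K%:E)%E.
Proof.
move=> h K0; apply: ge_ereal_sup => _ [d /= d1 <-]; rewrite lee_fin.
by apply: le_trans (h d) _; rewrite ler_piMr.
Qed.

Lemma bounded_subsequence_pair m (d : nat -> 'cV[R]_m * R) (M : R) :
  (forall j, pnorm (d j) <= M) ->
  exists (phi : nat -> nat) (l : 'cV[R]_m * R),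
    (forall j, (j <= phi j)%N) /\ d (phi j) @[j --> \oo] --> l.
Proof.
move=> dM.
have [|phi [a [phik al]]] := @bounded_subsequence R m (fun j => (d j).1) M.
  by move=> j; apply: le_trans (pnorm_fst _) (dM j).
have [|psi [b [psik bl]]] :=
  @bounded_subsequence R 1 (fun j => (d (phi j)).2%:M) M.
  move=> j; apply: le_trans _ (dM (phi j)); apply: le_trans _ (pnorm_snd _).
  by rewrite /enorm dotE big_ord1 mxE mulr1n -expr2 sqrtr_sqr.
exists (fun j => phi (psi j)), (a, b 0 0); split.
  by move=> j; apply: leq_trans (psik j) (phik _).
have -> : (fun j => d (phi (psi j))) = (fun j => ((d (phi (psi j))).1, (d (phi (psi j))).2)).
  by apply/funext => j; rewrite -surjective_pairing.
have ca : (d (phi (psi j))).1 @[j --> \oo] --> a.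
  exact: (cvg_comp _ _ (cvg_subseq psik) al).
have cb : (d (phi (psi j))).2 @[j --> \oo] --> b 0 0.
  have := [elaborate cvg_coord (i := 0) bl].
  by under eq_fun do rewrite mxE mulr1n.
exact: (cvg_pair ca cb).
Qed.

(** Maximal directions exist when the directional derivatives are bounded near
    the point: the upper limit is then finite and almost attained. *)
Lemma maximal_limit_direction_exists m n (f : 'cV[R]_m * R -> 'cV[R]_n) (p : 'cV[R]_m * R) (r K : R) :
  0 < r -> 0 <= K ->
  (forall q d, `|q - p| < r -> enorm (dir_derivative f q d) <= K * pnorm d) ->
  exists d, maximal_limit_direction f p d.
Proof.
move=> r0 K0 der; set F := max_dir_derivative f.
pose ball e : set ('cV[R]_m * R) := [set q | `|q - p| < e].
have FK q : `|q - p| < r -> (F q <= K%:E)%E.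
  by move=> qr; apply: max_dir_derivative_le => // d; exact: der.
have Fge q d : pnorm d <= 1 -> ((enorm (dir_derivative f q d))%:E <= F q)%E.
  by move=> d1; apply: ereal_sup_ubound; exists d.
have F0 q : (0 <= F q)%E.
  by apply: le_trans (Fge q 0 _); rewrite ?lee_fin ?enorm_ge0 // pnorm0 ler01.
set l := limf_esup F (nbhs p).
have lK : (l <= K%:E)%E.
  apply: (@le_trans _ _ (ereal_sup (F @` (ball r)))).
    by apply: ereal_inf_lbound; exists (ball r) => //; apply/near_ballP; exists r.
  by apply: ge_ereal_sup => _ [q qr <-]; exact: FK.
have l0 : (0 <= l)%E.
  apply: le_ereal_inf_tmp => _ [V /nbhs_singleton Vp <-].
  by apply: le_trans (F0 p) _; apply: ereal_sup_ubound; exists p.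
have [L lE] : exists L, l = L%:E by case: (l) l0 lK => [L _ _| |] //; exists L.
have ex j : exists qd : ('cV[R]_m * R) * ('cV[R]_m * R),
    [/\ `|qd.1 - p| < Num.min r (harmonic j), pnorm qd.2 <= 1 &
        L - harmonic j < enorm (dir_derivative f qd.1 qd.2)].
  have h0 : 0 < harmonic j :> R by rewrite /= invr_gt0 ltr0n.
  have rj : 0 < Num.min r (harmonic j) by rewrite lt_min r0.
  have lt1 : ((L - harmonic j)%:E < ereal_sup (F @` (ball (Num.min r (harmonic j)))))%E.
    apply: (@lt_le_trans _ _ l); first by rewrite lE lte_fin ltrBlDr ltrDl.
    apply: ereal_inf_lbound; exists (ball (Num.min r (harmonic j))) => //.
    by apply/near_ballP; exists (Num.min r (harmonic j)).
  have [_ [q qr <-] /ereal_sup_gt[_ [d /= d1 <-]]] := ereal_sup_gt lt1.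
  by rewrite lte_fin => h; exists (q, d).
have [qd qdP] := choice ex.
have [|phi [dl [phik dlim]]] := @bounded_subsequence_pair m (fun j => (qd j).2) 1.
  by move=> j; case: (qdP j).
have harml : harmonic (phi j) @[j --> \oo] --> (0 : R).
  exact: (cvg_comp _ _ (cvg_subseq phik) (@cvg_harmonic R)).
exists dl; exists (fun j => (qd (phi j)).1), (fun j => (qd (phi j)).2).
have ql : (qd (phi j)).1 @[j --> \oo] --> p.
  apply/cvgrPdist_lt => e e0.
  move/cvgrPdist_lt : harml => /(_ e e0); apply: filterS => j.
  rewrite sub0r normrN gtr0_norm ?invr_gt0 ?ltr0n // => h.
  rewrite distrC; apply: lt_trans h.
  by case: (qdP (phi j)) => + _ _; rewrite lt_min => /andP[].
have upper e : 0 < e -> \forall j \near \oo, (F (qd (phi j)).1 < (L + e)%:E)%E.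
  move=> e0; have : (l < (L + e)%:E)%E by rewrite lE lte_fin ltrDl.
  move=> /ereal_inf_lt[_ [V Vp <-] VL]; 
  have Vq : \forall j \near \oo, V (qd (phi j)).1 := ql _ Vp.
  apply: filterS Vq => j Vj.
  by apply: le_lt_trans VL; apply: ereal_sup_ubound; exists (qd (phi j)).1.
have Ffin j : F (qd (phi j)).1 \is a fin_num.
  have qr : `|(qd (phi j)).1 - p| < r.
    by case: (qdP (phi j)) => + _ _; rewrite lt_min => /andP[].
  by have := F0 (qd (phi j)).1; have := FK _ qr; case: (F _).
have sandwich (g : nat -> R) : (forall j, L - harmonic (phi j) <= g j) ->
   (forall j, ((g j)%:E <= F (qd (phi j)).1)%E) -> g j @[j --> \oo] --> L.
  move=> lo hi; apply/cvgrPdist_lt => e e0.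
  have hn : \forall j \near \oo, harmonic (phi j) < e.
    move/cvgrPdist_lt : harml => /(_ e e0); apply: filterS => j.
    by rewrite sub0r normrN gtr0_norm ?invr_gt0 ?ltr0n.
  apply: filterS2 hn (upper e e0) => j h1 h2.
  have := le_lt_trans (hi j) h2; rewrite lte_fin.
  by have := lo j; rewrite ltr_distlC => h3 h4; apply/andP; split; lra.
split => //.
- by move=> j; case: (qdP (phi j)).
- rewrite -/l -/F lE; apply/fine_cvgP; split; first by apply: nearW.
  apply: sandwich => j /=; last by rewrite fineK.
  rewrite -lee_fin fineK //; have [_ d1 h] := qdP (phi j).
  by apply: le_trans (Fge _ _ d1); rewrite lee_fin ltW.
- rewrite -/l lE; apply/fine_cvgP; split; first by apply: nearW.
  by apply: sandwich => j /=; have [_ d1 /ltW //] := qdP (phi j); move=> _; exact: Fge.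
Qed.

End MeanValue.

(** * The kernel of the generalized Hessian *)
Section Kernel.
Variable R : realType.

Lemma near_enormP n (x : 'cV[R]_n) (Q : set 'cV[R]_n) :
  (\forall y \near x, Q y) <->
  exists2 e : R, 0 < e & forall y, enorm (y - x) < e -> Q y.
Proof.
split.
  move=> /nbhs_ballP[e e0 h]; exists e => // y ye; apply: h.
  rewrite -ball_normE /ball_ /= distrC.
  exact: le_lt_trans (mxnorm_le_enorm _) ye.
move=> [e e0 h]; apply/nbhs_ballP; exists (e / n.+1%:R); first by rewrite /= divr_gt0.
move=> y; rewrite -ball_normE /ball_ /= distrC ltr_pdivlMr // => ye; apply: h.
apply: le_lt_trans (enorm_le_mxnorm _) (le_lt_trans _ ye).
by rewrite mulrC ler_wpM2l // ler_nat.
Qed.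

Lemma dot_col_mx n p (a c : 'cV[R]_n) (b d : 'cV[R]_p) :
  dot (col_mx a b) (col_mx c d) = dot a c + dot b d.
Proof. by rewrite /dot tr_col_mx mul_row_col mxE. Qed.

Lemma enorm_usubmx n p (z : 'cV[R]_(n + p)) : enorm (usubmx z) <= enorm z.
Proof.
rewrite -(@ler_pXn2r _ 2) // ?nnegrE ?enorm_ge0 // !sqr_enorm.
by rewrite -[z in X in _ <= X]vsubmxK dot_col_mx lerDl dot_ge0.
Qed.

Lemma enorm_dsubmx n p (z : 'cV[R]_(n + p)) : enorm (dsubmx z) <= enorm z.
Proof.
rewrite -(@ler_pXn2r _ 2) // ?nnegrE ?enorm_ge0 // !sqr_enorm.
by rewrite -[z in X in _ <= X]vsubmxK dot_col_mx lerDr dot_ge0.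
Qed.

Lemma regular_normal_le0 n (C : set 'cV[R]_n) (z v D : 'cV[R]_n) (t0 : R) :
  regular_normal C z v -> 0 < t0 -> (forall t, 0 < t -> t <= t0 -> C (z + t *: D)) ->
  dot v D <= 0.
Proof.
move=> [_ reg] t00 CD; apply/ler_addgt0Pr => e e0; rewrite add0r.
have D1 : 0 < enorm D + 1 by rewrite ltr_wpDl // enorm_ge0.
have [r r0 hr] := (near_enormP _ _).1 (reg _ (divr_gt0 e0 D1)).
pose t := Num.min t0 (r / (2 * (enorm D + 1))).
have tp : 0 < t by rewrite lt_min t00 divr_gt0 // mulr_gt0.
have tD : t * (2 * (enorm D + 1)) <= r.
  by rewrite -ler_pdivlMr ?mulr_gt0 // ge_min lexx orbT.
have tt0 : t <= t0 by rewrite ge_min lexx.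
have E : z + t *: D - z = t *: D by rewrite addrAC subrr add0r.
have := hr (z + t *: D); rewrite E enormZ gtr0_norm // dotZr.
have tDp : 0 < t * (enorm D + 1) by rewrite mulr_gt0.
have lt1 : t * enorm D < r by lra.
move=> /(_ lt1 (CD t tp tt0)) h.
have {}h : t * dot v D <= t * (e / (enorm D + 1) * enorm D) by rewrite mulrCA.
rewrite ler_pM2l // in h; apply: le_trans h _.
by rewrite mulrAC ler_pdivrMr // ler_pM2l // lerDl.
Qed.

Variables (n k : nat) (B : 'M[R]_n) (P : 'M[R]_(n, k)) (beta : 'cV[R]_k).
Hypothesis psdB : psd B.
Let C := polyhedron P beta.
Variables (xbar vbar : 'cV[R]_n).
Hypothesis xv : vi B P beta xbar vbar.

Let G := gph (subdiff (plq C B)).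

Lemma graph_subdiff z : G z <-> vi B P beta (usubmx z) (dsubmx z).
Proof.
by rewrite /G /gph /=; apply: subdiff_plq => //; exists vbar; case: xv.
Qed.

(** Near the reference pair the graph contains the segments in the directions
    (B d, d) with d orthogonal to the active normals, which forces regular
    normals, and hence their limits, to be orthogonal to these directions. *)
Lemma kernel_sub_span w : map_kernel (generalized_hessian (plq C B) xbar vbar) w ->
  w \in active_span P beta vbar.
Proof.
move=> [_ [zs [ns [reg zl nl]]]]; apply/active_spanP => d dv.
pose D := col_mx (B *m d) d.
have [e e0 he] := active_near (proj1 xv).
have orth : \forall j \near \oo, dot (ns j) D = 0.
  have near_z : \forall j \near \oo, enorm (zs j - col_mx xbar vbar) < e.
    apply: (zl [set z | enorm (z - col_mx xbar vbar) < e]).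
    by apply/near_enormP; exists e.
  apply: filterS near_z => j zj.
  have act : active P beta (dsubmx (zs j)) \subset active P beta vbar.
    apply: he; apply: le_lt_trans zj; apply: le_trans _ (enorm_dsubmx _).
    by rewrite linearB /= col_mxKd.
  have Gj : G (zs j) by case: (reg j).
  have /graph_subdiff xvj := Gj.
  have [|t0 t00 ht] := @vi_shift _ _ _ _ _ _ _ _ d xvj.
    by move=> i /(fintype.subsetP act); exact: dv.
  have GD t : `|t| <= t0 -> G (zs j + t *: D).
    move=> tt; apply/graph_subdiff.
    by rewrite !linearD !linearZ /= col_mxKu col_mxKd; exact: ht.
  apply/eqP; rewrite eq_le; apply/andP; split.
    apply: (regular_normal_le0 (reg j) t00) => t tp tt.
    by apply: GD; rewrite gtr0_norm.
  rewrite -oppr_le0 -dotNr; apply: (regular_normal_le0 (reg j) t00) => t tp tt.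
  by rewrite scalerN -scaleNr; apply: GD; rewrite normrN gtr0_norm.
have dl := [elaborate cvg_dot nl (cvg_cst D)].
have : dot (col_mx 0 (- w)) D = 0.
  apply/eqP; rewrite eq_le; apply/andP; split.
    by apply: (cvgr_to_le dl); apply: filterS orth => j /= ->.
  by apply: (cvgr_to_ge dl); apply: filterS orth => j /= ->.
by rewrite dot_col_mx dot0l add0r dotNl => /eqP; rewrite oppr_eq0 => /eqP.
Qed.

(** Adding a small positive combination of all active normals makes strict
    complementarity hold.  There the graph is locally contained in the set of
    pairs whose second component moves orthogonally to the active normals, so
    every (0, -w) with w in their span is a regular normal. *)
Lemma span_sub_kernel w : w \in active_span P beta vbar ->
  map_kernel (generalized_hessian (plq C B) xbar vbar) w.
Proof.
move=> wW; pose Iv := active P beta vbar.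
pose q : 'cV[R]_n := \sum_(i in Iv) 1 *: col i P.
have qdot y : dot q y = \sum_(i in Iv) dot (col i P) y.
  by rewrite dot_suml; apply: eq_bigr => i _; rewrite mul1r.
have qW : q \in active_span P beta vbar.
  apply/active_spanP => d dv; rewrite qdot big1 // => i; exact: dv.
have p_le0 v i : C v -> i \in Iv -> dot (col i P) (v - vbar) <= 0.
  move=> /in_polyhedron/(_ i) Cv; rewrite activeE => /eqP iv.
  by rewrite dotDr dotNr iv subr_le0.
have q_le0 v : C v -> dot q (v - vbar) <= 0.
  by move=> Cv; rewrite qdot sumr_le0 // => i; exact: p_le0.
have qsum v : C v -> \sum_(i in Iv) `|dot (col i P) (v - vbar)| = - dot q (v - vbar).
  move=> Cv; rewrite qdot -sumrN; apply: eq_bigr => i iv.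
  by rewrite ler0_norm // p_le0.
have [Cv hv] := xv.
have vik (h : R) : 0 < h -> vi B P beta (xbar + h *: q) vbar.
  move=> h0; split => // z Cz; rewrite addrAC dotDl dotZl.
  have : h * dot q (z - vbar) <= 0 by rewrite pmulr_rle0 // q_le0.
  have := hv z Cz; lra.
have Gx : G (col_mx xbar vbar) by apply/graph_subdiff; rewrite col_mxKu col_mxKd.
split => //; exists (fun j => col_mx xbar vbar + harmonic j *: col_mx q 0), (fun=> col_mx 0 (- w)).
split; last exact: cvg_cst; last first.
  rewrite -[X in _ --> X]addr0; apply: cvgD; first exact: cvg_cst.
  rewrite -[X in _ --> X](scale0r (col_mx q 0)).
  by apply: cvgZ; [exact: cvg_harmonic | exact: cvg_cst].
move=> j; have h0 : 0 < harmonic j :> R by rewrite /= invr_gt0 ltr0n.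
set h : R := harmonic j in h0 *.
have zE : col_mx xbar vbar + h *: col_mx q 0 = col_mx (xbar + h *: q) vbar.
  by rewrite scale_col_mx add_col_mx scaler0 addr0.
rewrite zE; split; first by apply/graph_subdiff; rewrite col_mxKu col_mxKd; exact: vik.
move=> e e0; apply/near_enormP.
have [ea ea0 hea] := active_near Cv.
have [K K0 hK] := span_dot_bound P beta vbar.
have L0 : 0 < (K + 1) * (1 + frobenius B).
  by have := frobenius_ge0 B => fB; apply: mulr_gt0; lra.
exists (Num.min ea (h / ((K + 1) * (1 + frobenius B)))).
  by rewrite lt_min ea0 divr_gt0.
move=> z; rewrite lt_min => /andP[z1]; rewrite ltr_pdivlMr // => z2 /graph_subdiff xvz.
set x := usubmx z in xvz *; set v := dsubmx z in xvz *.
set N := enorm _ in z1 z2 *.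
have N0 : 0 <= N := enorm_ge0 _.
have vN : enorm (v - vbar) <= N.
  by apply: le_trans _ (enorm_dsubmx _); rewrite linearB /= col_mxKd.
have xN : enorm (x - (xbar + h *: q)) <= N.
  by apply: le_trans _ (enorm_usubmx _); rewrite linearB /= col_mxKu.
have act : active P beta v \subset Iv by apply: hea; exact: le_lt_trans vN z1.
have Cvz : C v by case: xvz.
pose del := (x - B *m v) - (xbar + h *: q - B *m vbar).
have delW : del \in active_span P beta vbar.
  by rewrite memvB // vi_in_span //; exact: vik.
have delN : enorm del <= (1 + frobenius B) * N.
  have -> : del = (x - (xbar + h *: q)) - B *m (v - vbar).
    rewrite /del mulmxBr; move: (xbar + _) (B *m v) (B *m vbar) => a b c.
    by apply/colP => i; rewrite !mxE; ring.
  apply: le_trans (enormBD _ _) _; rewrite mulrDl mul1r lerD //.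
  by apply: le_trans (enorm_mulmx _ _) _; rewrite ler_wpM2l ?frobenius_ge0.
set s := \sum_(i in Iv) `|dot (col i P) (v - vbar)|.
(* The strictly complementary normal charges s with weight h, while the deviation
   del of the normal can only compensate K |del| s < h s. *)
have s0 : s = 0.
  have s_ge0 : 0 <= s by rewrite sumr_ge0.
  have sE : s = - dot q (v - vbar) := qsum _ Cvz.
  have h1 : dot del (v - vbar) <= K * enorm del * s := hK _ _ delW.
  have h2 : 0 <= dot (x - B *m v) (v - vbar).
    have := (proj2 xvz) _ Cv; by rewrite -(opprB v vbar) dotNr oppr_le0.
  have h3 := hv _ Cvz.
  have h4 : h * s <= K * enorm del * s.
    move: h1 h2 h3; rewrite sE /del.
    rewrite -(addrA xbar) (addrC (h *: q)) addrA.
    move: (x - _) (xbar - _) (v - vbar) => a b c.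
    by rewrite opprD addrA !dotDl !dotNl dotZl; lra.
  have h5 : K * enorm del < h.
    have t1 : K * enorm del <= K * ((1 + frobenius B) * N) by rewrite ler_wpM2l.
    have t2 : 0 <= (1 + frobenius B) * N by rewrite mulr_ge0 // addr_ge0 // frobenius_ge0.
    by move: z2; lra.
  apply/eqP; rewrite eq_le s_ge0 andbT leNgt; apply/negP => s_gt0.
  by move: h4; rewrite ler_pM2r // leNgt h5.
have wv : dot w (v - vbar) = 0.
  apply: ((active_spanP _ _ _ _).1 wW) => i iv.
  move: s0; rewrite /s => /eqP; rewrite psumr_eq0 // => /allP/(_ i (mem_index_enum i)).
  by rewrite iv /= normr_eq0 => /eqP.
have -> : z - col_mx (xbar + h *: q) vbar = col_mx (x - (xbar + h *: q)) (v - vbar).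
  by rewrite -[z]vsubmxK opp_col_mx add_col_mx.
by rewrite dot_col_mx dot0l add0r dotNl wv oppr0 mulr_ge0 ?enorm_ge0 // ltW.
Qed.

End Kernel.

(** * The solution map near the reference parameter *)
Section SolutionMap.
Variables (R : realType) (m n k : nat) (A : 'M[R]_(m, n)) (B : 'M[R]_n)
  (P : 'M[R]_(n, k)) (beta : 'cV[R]_k).
Hypothesis psdB : psd B.
Variables (bbar : 'cV[R]_m) (lbar : R) (xbar : 'cV[R]_n).
Hypothesis lbar_gt0 : 0 < lbar.
Let pbar : 'cV[R]_m * R := (bbar, lbar).
Hypothesis xbar_sol : is_sol B P beta A pbar xbar.
Let vbar := dual_point A pbar xbar.
Hypothesis criterion :
  mx_ker A `&` [set x | x \in active_span P beta vbar] = [set 0].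
Let S := solution_map A B P beta.
Let s := selection S.

Lemma local_solution_map : exists delta kappa : R, [/\ 0 < delta, 0 <= kappa,
  forall p, `|p - pbar| < delta -> [/\ 0 < p.2, S p = [set s p],
    is_sol B P beta A p (s p) &
    active P beta (dual_point A p (s p)) \subset active P beta vbar] &
  forall p1 p2, `|p1 - pbar| < delta -> `|p2 - pbar| < delta ->
    enorm (s p1 - s p2) <= kappa * pnorm (p1 - p2)].
Proof.
have [d1 [kappa [d10 K0 half act lip]]] := near_lipschitz psdB lbar_gt0 xbar_sol criterion.
have [d2 d20 ex] := sol_exists psdB lbar_gt0 xbar_sol criterion.
have C0 : polyhedron P beta !=set0 by exists vbar; case: xbar_sol.
have good p : `|p - pbar| < Num.min d1 d2 -> [/\ 0 < p.2, S p = [set s p],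
    is_sol B P beta A p (s p) &
    active P beta (dual_point A p (s p)) \subset active P beta vbar].
  rewrite lt_min => /andP[p1 p2].
  have p0 : 0 < p.2 by apply: lt_le_trans (half _ p1); rewrite divr_gt0.
  have [x xs] := ex _ p2.
  have Sx : S p = [set x].
    apply/seteqP; split=> [y /(solution_mapP psdB A _ C0 p0) ys|y ->]; last first.
      exact/(solution_mapP psdB).
    apply/eqP; rewrite -subr_eq0; apply/eqP/enorm_eq0/eqP.
    rewrite eq_le enorm_ge0 andbT.
    by have := lip _ _ _ _ p1 p1 ys xs; rewrite subrr pnorm0 mulr0.
  have sx : s p = x by rewrite /s /selection Sx; apply: (@getPex _ [set x]); exists x.
  by rewrite sx; split => //; exact: act.
exists (Num.min d1 d2), kappa; split => //; first by rewrite lt_min d10.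
move=> p1 p2 h1 h2; have [_ _ s1 _] := good _ h1; have [_ _ s2 _] := good _ h2.
by move: h1 h2; rewrite !lt_min => /andP[h1 _] /andP[h2 _]; exact: lip.
Qed.

Lemma selection_at_pbar : s pbar = xbar.
Proof.
have [delta [kappa [d0 _ good _]]] := local_solution_map.
have [|_ SE _ _] := good pbar; first by rewrite subrr normr0.
have C0 : polyhedron P beta !=set0 by exists vbar; case: xbar_sol.
by have /(solution_mapP psdB A xbar C0 (lbar_gt0 : 0 < pbar.2)) := xbar_sol; rewrite -/S SE => ->.
Qed.

Section Neighbourhood.
Variables (delta kappa : R).
Hypothesis good : forall p, `|p - pbar| < delta -> [/\ 0 < p.2, S p = [set s p],
    is_sol B P beta A p (s p) &
    active P beta (dual_point A p (s p)) \subset active P beta vbar].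
Hypothesis lip : forall p1 p2, `|p1 - pbar| < delta -> `|p2 - pbar| < delta ->
    enorm (s p1 - s p2) <= kappa * pnorm (p1 - p2).

(** Difference quotients are bounded by the Lipschitz estimate and all their
    limit points solve the linearised inclusion. *)
Lemma selection_dir_derivative (p d : 'cV[R]_m * R) : `|p - pbar| < delta ->
  [/\ dir_quotient s p d t @[t --> 0^'+] --> dir_derivative s p d,
      linearised A B P beta p (s p) d (dir_derivative s p d) &
      enorm (dir_derivative s p d) <= kappa * pnorm d].
Proof.
move=> pd; have [p0 _ sp actp] := good pd.
suff [xi xil [lin xiK]] : exists2 xi, dir_quotient s p d t @[t --> 0^'+] --> xi &
    linearised A B P beta p (s p) d xi /\ enorm xi <= kappa * pnorm d.
  have -> : dir_derivative s p d = xi by apply: cvg_lim xil; exact: norm_hausdorff.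
  by [].
apply: (@cvg_right_unique R n _ (fun xi => linearised A B P beta p (s p) d xi /\
    enorm xi <= kappa * pnorm d)); last first.
  by move=> xi xi' [l _] [l' _]; exact: (linearised_unique psdB p0 sp actp criterion l l').
move=> u u0 ul.
have [N Nd] : exists N, forall j, (N <= j)%N -> `|p + u j *: d - pbar| < delta.
  have d1 : 0 < `|d| + 1 by rewrite ltr_wpDl.
  have e0 : 0 < (delta - `|p - pbar|) / (`|d| + 1) by rewrite divr_gt0 // subr_gt0.
  move/cvgrPdist_lt : ul => /(_ _ e0) [N _ hN]; exists N => j /hN /=.
  rewrite sub0r normrN gtr0_norm // ltr_pdivlMr // => h.
  rewrite addrAC; apply: le_lt_trans (ler_normD _ _) _; rewrite normrZ gtr0_norm //.
  have := u0 j; lra.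
pose xis j := dir_quotient s p d (u (j + N)%N).
have xisE j : s p + u (j + N)%N *: xis j = s (p + u (j + N)%N *: d).
  by rewrite /xis /dir_quotient scalerA divff ?lt0r_neq0 // scale1r addrC subrK.
have xisK j : enorm (xis j) <= kappa * pnorm d.
  rewrite /xis /dir_quotient enormZ gtr0_norm ?invr_gt0 // mulrC ler_pdivrMr //.
  apply: le_trans (lip (Nd _ (leq_addl _ _)) pd) _.
  by rewrite addrAC subrr add0r pnormZ gtr0_norm // mulrCA mulrC.
have [phi [xi [phik xil]]] := bounded_subsequence xisK.
exists (fun j => (phi j + N)%N), xi; split => //.
  by move=> j; apply: leq_trans (phik j) (leq_addr _ _).
split.
  have u'l : u (phi j + N)%N @[j --> \oo] --> (0 : R).
    apply: (cvg_comp _ _ (cvg_subseq _) ul) => j.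
    exact: leq_trans (phik j) (leq_addr _ _).
  apply: (quotient_limit p0 sp _ u'l _ _ xil) => j; first exact: u0.
    by case: (good (Nd _ (leq_addl (phi j) N))).
  by rewrite xisE; case: (good (Nd _ (leq_addl (phi j) N))).
have dl := [elaborate cvg_enorm xil].
by apply: (cvgr_to_le dl); apply: nearW => j; exact: xisK.
Qed.

(** Membership of the normal part in the span and its orthogonality to the dual
    part are closed conditions, and they are all that the closed formula requires. *)
Lemma limit_of_derivatives (p d : nat -> 'cV[R]_m * R) (dbar : 'cV[R]_m * R) :
  0 < delta -> 0 <= kappa ->
  p j @[j --> \oo] --> pbar -> d j @[j --> \oo] --> dbar ->
  (forall j, pnorm (d j) <= 1) ->
  exists (phi : nat -> nat) (xi : 'cV[R]_n) (r : nat) (U : 'M[R]_(n, r)),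
   [/\ forall j, (j <= phi j)%N,
       dir_derivative s (p (phi j)) (d (phi j)) @[j --> \oo] --> xi,
       [/\ U^T *m U = 1%:M, (r <= #|active P beta vbar|)%N &
        gram_mx A (H_mx A B lbar) U \in unitmx] &
       xi = sensitivity_mx A B lbar U *m effective A pbar xbar dbar].
Proof.
move=> delta0 kappa0 pl dl d1.
have [N Nd] : exists N, forall j, (N <= j)%N -> `|p j - pbar| < delta.
  have : \forall j \near \oo, `|p j - pbar| < delta.
    by apply: (pl [set q | `|q - pbar| < delta]); apply/near_ballP; exists delta.
  by case=> N _ hN; exists N => j /hN.
pose xis j := dir_derivative s (p (j + N)%N) (d (j + N)%N).
have spec j := selection_dir_derivative (d (j + N)%N) (Nd _ (leq_addl j N)).
have xisK j : enorm (xis j) <= kappa.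
  have [_ _ h] := spec j; apply: le_trans h _.
  by rewrite ler_piMr.
have [phi [xi [phik xil]]] := bounded_subsequence xisK.
pose psi j := (phi j + N)%N.
have psik j : (j <= psi j)%N by apply: leq_trans (phik j) (leq_addr _ _).
have {}pl : p (psi j) @[j --> \oo] --> pbar := cvg_comp _ _ (cvg_subseq psik) pl.
have {}dl : d (psi j) @[j --> \oo] --> dbar := cvg_comp _ _ (cvg_subseq psik) dl.
have p2l : (p (psi j)).2 @[j --> \oo] --> lbar by exact: (cvg_comp _ _ pl cvg_snd).
have p1l : (p (psi j)).1 @[j --> \oo] --> bbar by exact: (cvg_comp _ _ pl cvg_fst).
have d2l : (d (psi j)).2 @[j --> \oo] --> dbar.2 by exact: (cvg_comp _ _ dl cvg_snd).
have d1l : (d (psi j)).1 @[j --> \oo] --> dbar.1 by exact: (cvg_comp _ _ dl cvg_fst).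
have p2Vl : ((p (psi j)).2)^-1 @[j --> \oo] --> lbar^-1.
  by apply: cvgV => //; exact: lt0r_neq0.
have sl : s (p (psi j)) @[j --> \oo] --> xbar.
  apply/cvgrPdist_lt => e e0; rewrite -selection_at_pbar.
  have K1 : 0 < kappa * m.+1%:R + 1 by rewrite ltr_wpDl // mulr_ge0.
  move/cvgrPdist_lt : pl => /(_ _ (divr_gt0 e0 K1)); apply: filterS => j.
  rewrite ltr_pdivlMr // distrC => h; rewrite distrC.
  apply: le_lt_trans (mxnorm_le_enorm _) _.
  have pb : `|pbar - pbar| < delta by rewrite subrr normr0.
  apply: le_lt_trans (lip (Nd _ (leq_addl (phi j) N)) pb) _.
  have := ler_wpM2l kappa0 (pnorm_le_norm (p (psi j) - pbar)).
  have := normr_ge0 (p (psi j) - pbar); rewrite /psi in h *; lra.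
have rl : residual A (p (psi j)) (s (p (psi j))) @[j --> \oo] --> residual A pbar xbar.
  by apply: cvgZ => //; apply: cvgB => //; exact: cvg_mulmx.
have wl : effective A (p (psi j)) (s (p (psi j))) (d (psi j)) @[j --> \oo] -->
    effective A pbar xbar dbar.
  by apply: cvgB => //; exact: cvgZ.
set w := effective A pbar xbar dbar in wl *.
pose nu j := dual_rate A (p (psi j)).2
  (effective A (p (psi j)) (s (p (psi j))) (d (psi j))) (xis (phi j)).
have nul : nu j @[j --> \oo] --> dual_rate A lbar w xi.
  by apply: cvgZ => //; apply: cvg_mulmx; apply: cvgB => //; exact: cvg_mulmx.
have mul : xis (phi j) - B *m nu j @[j --> \oo] --> normal_rate A B lbar w xi.
  by apply: cvgB => //; exact: cvg_mulmx.
have muW : normal_rate A B lbar w xi \in active_span P beta vbar.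
  apply/active_spanP => e ev; have el := [elaborate cvg_dot mul (cvg_cst e)].
  have e0 j : dot (xis (phi j) - B *m nu j) e = 0.
    have [_ lin _] := spec (phi j).
    have [_ _ sj actj] := good (Nd _ (leq_addl (phi j) N)).
    have := linearised_in_span sj actj lin.
    by move/active_spanP => /(_ e ev).
  apply/eqP; rewrite eq_le; apply/andP; split.
    by apply: (cvgr_to_le el); apply: nearW => j; rewrite e0.
  by apply: (cvgr_to_ge el); apply: nearW => j; rewrite e0.
have ort : dot (normal_rate A B lbar w xi) (dual_rate A lbar w xi) = 0.
  have el := [elaborate cvg_dot mul nul].
  have e0 j : dot (xis (phi j) - B *m nu j) (nu j) = 0.
    by have [_ [_ h _] _] := spec (phi j).
  apply/eqP; rewrite eq_le; apply/andP; split.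
    by apply: (cvgr_to_le el); apply: nearW => j; rewrite e0.
  by apply: (cvgr_to_ge el); apply: nearW => j; rewrite e0.
have [r [U [U1 rI gu xiE]]] := sensitivity_representation psdB lbar_gt0 criterion muW ort.
by exists psi, xi, r, U.
Qed.

End Neighbourhood.

Lemma effective_pbar (d : 'cV[R]_m * R) :
  effective A pbar xbar d = d.1 + (d.2 / lbar) *: (A *m xbar - bbar).
Proof.
by rewrite /effective /residual /= scalerA -scalerN opprB.
Qed.

Lemma lipschitz_modulus_bound (dbar : 'cV[R]_m * R) :
  maximal_limit_direction s pbar dbar ->
  (lipschitz_modulus s pbar <=
   modulus_bound A B P beta lbar vbar (effective A pbar xbar dbar))%E.
Proof.
have [delta [kappa [d0 K0 good lip]]] := local_solution_map.
move=> [p [d [pl d1 _ el dl]]].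
apply: (@le_trans _ _ (limf_esup (max_dir_derivative s) (nbhs pbar))).
  apply: (lipschitz_modulus_le d0 lip) => q e qd.
  by case: (selection_dir_derivative good lip e qd).
have [phi [xi [r [U [phik xil [U1 rI gu] xiE]]]]] :=
  limit_of_derivatives good lip d0 K0 pl dl d1.
have -> : limf_esup (max_dir_derivative s) (nbhs pbar) = (enorm xi)%:E.
  have h1 := cvg_comp _ _ (cvg_subseq phik) el.
  have h2 : (enorm (dir_derivative s (p (phi j)) (d (phi j))))%:E @[j --> \oo] --> (enorm xi)%:E.
    by apply: cvg_EFin; [exact: nearW | exact: cvg_enorm].
  exact: (cvg_unique (@ereal_hausdorff R) h1 h2).
by apply: ereal_sup_ubound; exists r, U; rewrite xiE.
Qed.

End SolutionMap.

Theorem corollary5p14 (R : realType) (m n k : nat)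
    (A : 'M[R]_(m, n)) (B : 'M[R]_n) (P : 'M[R]_(n, k)) (beta : 'cV[R]_k)
    (bbar : 'cV[R]_m) (lbar : R) (xbar : 'cV[R]_n)
    (psdB : psd B) (polyhedron0 : polyhedron P beta !=set0)
    (lbar_gt0 : 0 < lbar)
    (xbarS : solution_map A B P beta (bbar, lbar) xbar) :
  let theta := plq (polyhedron P beta) B in
  let S := solution_map A B P beta in
  let s := selection S in
  let pbar := (bbar, lbar) in
  let vbar := - (lbar^-1 *: (A^T *m (A *m xbar - bbar))) in
  let H := H_mx A B lbar in
  let criterion :=
    mx_ker A `&` [set x | x \in active_span P beta vbar] = [set 0] in
  [/\ horizon_cone P `&` mx_ker B `&` mx_ker (1%:M : 'M[R]_n)^T = [set 0],
      mx_ker A `&` map_kernel (generalized_hessian theta xbar vbar) = [set 0]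
        <-> criterion
    & criterion ->
      [/\ H \in unitmx,
          (* (i) *)
          dir_differentiable s pbar /\
          (forall (q : 'cV[R]_m) (alpha : R),
             exists (r : nat) (U : 'M[R]_(n, r)),
             [/\ U^T *m U = 1%:M, gram_mx A H U \in unitmx
               & dir_derivative s pbar (q, alpha) =
                 sensitivity_mx A B lbar U
                   *m (q + (alpha / lbar) *: (A *m xbar - bbar))])
        & (* (ii) *)
          [/\ single_valued_around S pbar,
              locally_lipschitz_around s pbar,
              exists dbar, maximal_limit_direction s pbar dbar
            & forall (qbar : 'cV[R]_m) (alphabar : R),
                maximal_limit_direction s pbar (qbar, alphabar) ->
                (lipschitz_modulus s pbar <=
                 modulus_bound A B P beta lbar vbar
                   (qbar + (alphabar / lbar) *: (A *m xbar - bbar)))%E]]].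
Proof.
move=> theta S s pbar vbar H criterion.
have vbarE : vbar = dual_point A pbar xbar.
  rewrite /vbar /dual_point /residual -scalemxAr -scalerN -mulmxN opprB //.
have sol : is_sol B P beta A pbar xbar by exact/(solution_mapP psdB).
have kerE : map_kernel (generalized_hessian theta xbar vbar) =
    [set x | x \in active_span P beta vbar].
  have xv : vi B P beta xbar vbar by rewrite vbarE.
  apply/seteqP; split => w; first exact: kernel_sub_span.
  exact: span_sub_kernel.
split.
- apply/seteqP; split => [x [_]|x ->].
    by rewrite /mx_ker /= trmx1 mul1mx.
  split; last by rewrite /mx_ker /= mulmx0.
  by split; [move=> i; rewrite mulmx0 | rewrite /mx_ker /= mulmx0].
- by rewrite kerE.
rewrite /criterion vbarE => crit.
have [delta [kappa [d0 K0 good lip]]] := local_solution_map psdB lbar_gt0 sol crit.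
have pb : `|pbar - pbar| < delta by rewrite subrr normr0.
have sE : s pbar = xbar := selection_at_pbar psdB lbar_gt0 sol crit.
split; first exact: H_mx_unit.
- split=> [d|q alpha].
    have [h _ _] := selection_dir_derivative psdB crit good lip d pb.
    by apply/cvg_ex; exists (dir_derivative s pbar d).
  have [_ lin _] := selection_dir_derivative psdB crit good lip (q, alpha) pb.
  have [_ _ sb actb] := good _ pb.
  have muW := linearised_in_span sb actb lin.
  have [_ ort _] := lin.
  have [r [U [U1 _ gu xiE]]] := sensitivity_representation psdB lbar_gt0 crit muW ort.
  exists r, U; split => //; rewrite xiE; congr (_ *m _).
  by rewrite -/s sE (effective_pbar A bbar lbar xbar).
- split.
  + apply/near_ballP; exists delta => // p pd.
    by have [_ SE _ _] := good _ pd; exists (s p).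
  + exists kappa; apply: (near_pairP d0) => p p' pd pd' /=; exact: lip.
  + apply: (maximal_limit_direction_exists d0 K0) => q d qd.
    by case: (selection_dir_derivative psdB crit good lip d qd).
  + move=> qbar alphabar mld.
    have := lipschitz_modulus_bound psdB lbar_gt0 sol crit mld.
    by rewrite (effective_pbar A bbar lbar xbar).
Qed.
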